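(* Let $H$ be a graph and let $\mathcal{G}$ be the class of graphs that do not contain an induced subdivision of $H$. Then the following statements are equivalent: 1. $\mathcal{G}$ is tame. 2. $\mathcal{G}$ is not feral. 3. $H$ is an induced subgraph of $2P_2$, the diamond, or the house. 4. $H$ is an induced topological minor of $2P_2$ or of the house.
   Context: All graphs are finite, simple and undirected, and are considered up to isomorphism. A subdivision of a graph $H$ is any graph obtained from $H$ by repeatedly (zero or more times) replacing an edge $uv$ by two edges $uw$, $wv$ with $w$ a new vertex. $G$ contains an induced subdivision of $H$, equivalently $H$ is an induced topological minor of $G$, if some subdivision of $H$ is isomorphic to an induced subgraph of $G$. A minimal separator in $G$ is a set $S\subseteq V(G)$ for which there exist nonadjacent vertices $a,b\in V(G)\setminus S$ belonging to distinct connected components of $G-S$, while for every proper subset $S'\subsetneq S$ the vertices $a$ and $b$ are in the same connected component of $G-S'$. A graph class $\mathcal{G}$ is tame if there is a polynomial $p$ such that every $G\in\mathcal{G}$ has at most $p(|V(G)|)$ minimal separators. It is feral if there is a constant $c>1$ such that infinitely many (pairwise nonisomorphic) graphs $G\in\mathcal{G}$ have at least $c^{|V(G)|}$ minimal separators. $2P_2$ is the graph consisting of two disjoint edges on four vertices. The diamond is $K_4$ minus an edge. The house is the graph with vertices $a,b,c,d,e$ and edges $ab,bc,cd,de,ae,ad$. *)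

(* Defs.v *)
From HB Require Import structures.
From mathcomp Require Import all_boot all_order all_algebra.
From mathcomp Require Import reals.

Set Implicit Arguments.
Unset Strict Implicit.
Unset Printing Implicit Defensive.

Record sgraph := SGraph {
  vertex :> finType;
  adj : rel vertex;
  adj_sym : symmetric adj;
  adj_irrefl : irreflexive adj }.

Arguments adj {s} : rename.

Definition isomorphic (G G' : sgraph) : Prop :=
  exists2 f : G -> G', bijective f & forall x y, adj (f x) (f y) = adj x y.

Section Induced.
Variables (G : sgraph) (S : {set G}).

Definition induced_adj : rel {x : G | x \in S} := fun x y => adj (val x) (val y).

Lemma induced_adj_sym : symmetric induced_adj.
Proof. by move=> x y; apply: adj_sym. Qed.

Lemma induced_adj_irrefl : irreflexive induced_adj.
Proof. by move=> x; apply: adj_irrefl. Qed.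

Definition induced : sgraph := SGraph induced_adj_sym induced_adj_irrefl.
End Induced.

(* Graphs are taken up to isomorphism. *)
Definition induced_subgraph (H G : sgraph) : Prop :=
  exists S : {set G}, isomorphic H (induced S).

Section SubdivideEdge.
Variables (G : sgraph) (u v : G).

(* The edge uv is deleted and the new vertex None is joined to u and to v.
   This is a subdivision step only when u and v are adjacent. *)
Definition subdivide_edge_adj : rel (option G) := fun x y =>
  match x, y with
  | Some x, Some y => adj x y && ([set x; y] != [set u; v])
  | Some x, None | None, Some x => x \in [set u; v]
  | None, None => false
  end.

Lemma subdivide_edge_adj_sym : symmetric subdivide_edge_adj.
Proof. by case=> [x|] [y|] //=; rewrite adj_sym setUC. Qed.

Lemma subdivide_edge_adj_irrefl : irreflexive subdivide_edge_adj.
Proof. by case=> [x|] //=; rewrite adj_irrefl. Qed.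

Definition subdivide_edge : sgraph :=
  SGraph subdivide_edge_adj_sym subdivide_edge_adj_irrefl.
End SubdivideEdge.

Inductive subdivision (H : sgraph) : sgraph -> Prop :=
| subdivision_refl : subdivision H H
| subdivision_step (G : sgraph) (u v : G) :
    subdivision H G -> adj u v -> subdivision H (subdivide_edge u v).

(* Equivalently: G contains an induced subdivision of H. *)
Definition induced_topological_minor (H G : sgraph) : Prop :=
  exists2 H' : sgraph, subdivision H H' & induced_subgraph H' G.

Definition induced_subdivision_free (H G : sgraph) : Prop :=
  ~ induced_topological_minor H G.

(* For a and b outside S: a and b lie in the same component of G - S. *)
Definition same_component (G : sgraph) (S : {set G}) (a b : G) : bool :=
  connect [rel x y | [&& x \notin S, y \notin S & adj x y]] a b.

Definition minimal_separator (G : sgraph) (S : {set G}) : bool :=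
  [exists a : G, exists b : G,
    [&& a \notin S, b \notin S, ~~ adj a b, ~~ same_component S a b
      & [forall S' : {set G}, (S' \proper S) ==> same_component S' a b]]].

Definition minimal_separators (G : sgraph) : {set {set G}} :=
  [set S | minimal_separator S].

Section Growth.
Local Open Scope ring_scope.
Variables (R : realType) (C : sgraph -> Prop).

Definition tame : Prop :=
  exists p : {poly R}, forall G : sgraph, C G ->
    #|minimal_separators G|%:R <= p.[#|G|%:R].

Definition feral : Prop :=
  exists2 c : R, 1 < c & exists F : nat -> sgraph,
    (forall i j, i != j -> ~ isomorphic (F i) (F j)) /\
    (forall i, C (F i) /\ c ^+ #|F i| <= #|minimal_separators (F i)|%:R).
End Growth.

Section EdgeList.
Variables (n : nat) (s : seq (nat * nat)).

Definition edge_list_adj : rel 'I_n := fun x y =>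
  (x != y) && (((val x, val y) \in s) || ((val y, val x) \in s)).

Lemma edge_list_adj_sym : symmetric edge_list_adj.
Proof. by move=> x y; rewrite /edge_list_adj eq_sym orbC. Qed.

Lemma edge_list_adj_irrefl : irreflexive edge_list_adj.
Proof. by move=> x; rewrite /edge_list_adj eqxx. Qed.

Definition edge_list_graph : sgraph :=
  SGraph edge_list_adj_sym edge_list_adj_irrefl.
End EdgeList.

Definition two_P2 : sgraph := edge_list_graph 4 [:: (0, 1); (2, 3)].

Definition diamond : sgraph :=
  edge_list_graph 4 [:: (0, 1); (0, 2); (0, 3); (1, 2); (1, 3)].

(* The vertices a, b, c, d, e are 0, 1, 2, 3, 4: a 4-cycle abcd and a
   triangle ade sharing the edge ad. *)
Definition house : sgraph :=
  edge_list_graph 5 [:: (0, 1); (1, 2); (2, 3); (3, 4); (0, 4); (0, 3)].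

(* Main.v *)
Require Import Defs.
From HB Require Import structures.
From mathcomp Require Import all_boot all_order all_algebra.
From mathcomp Require Import reals ring.

(* Tame implies not feral by comparing growth rates along graphs of unbounded
   order.

   A graph [H] outside the list is excluded by one of two feral families of
   "ladders": two sides with a hub each, joined by an induced matching, the sides
   being both cliques or both stars centred at the hub. Choosing one end of every
   matching edge gives exponentially many separators of the hubs. A clique ladder
   contains no subdivision of a graph with three independent vertices, nor of a
   triangle-free graph on at least five vertices; a star ladder contains none of a
   graph with three vertices of degree at least 3, with a cycle and a vertex
   without neighbours on it, or with two cycles sharing at most one vertex, since
   all its cycles pass through both hubs. Every other graph on at most five vertices
   is in the list (a finite check). With six vertices or more, if at most two have
   degree at least 3, a vertex of degree at most 2 has three nonneighbours, which
   yield an independent triple or a triangle it does not see.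

   Conversely let [G] have no induced subdivision of the house, i.e. no theta other
   than the diamond and [K_{2,3}]. A vertex outside a hole of length at least 5 then
   sees at most one vertex of it, or all of it, or is a true twin of one of its
   vertices. Let [S] be a minimal separator with full components [A] and [B]. If no
   vertex of [A] dominates [S], take [a] in [A] with most neighbours in [S],
   [u] in [S] missed by [a], a shortest path in [A] from [a] to a neighbour [z] of [u],
   and [s] in [S] adjacent to [a] but not to [z]. The end of this path from the last
   neighbour of [s] on, closed through [B], is a hole, and every other vertex of [S]
   sees one of the two ends of its part in [A]: otherwise some connected set outside
   the hole attaches to both sides of it, which produces a theta. So two vertices of
   [A] and two of [B] determine [S], and there are at most [n^4] minimal separators.
   For [2P_2], one full component is a single vertex [a] and [S = N(a)]. *)

Set Implicit Arguments.
Unset Strict Implicit.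
Unset Printing Implicit Defensive.

(** * Embeddings and induced paths *)

Definition embeds (H G : sgraph) : Prop :=
  exists2 f : H -> G, injective f & forall x y, adj (f x) (f y) = adj x y.

Lemma embeds_trans (G H K : sgraph) : embeds G H -> embeds H K -> embeds G K.
Proof.
move=> [f finj fadj] [g ginj gadj]; exists (g \o f); first exact: inj_comp.
by move=> x y; rewrite /= gadj fadj.
Qed.

Lemma induced_subgraphP (H G : sgraph) : induced_subgraph H G <-> embeds H G.
Proof.
split=> [[S [f fbij fadj]]|[f finj fadj]].
  exists (fun x => val (f x)) => [x y /val_inj /(bij_inj fbij) //|x y].
  by rewrite -fadj.
pose S := [set f x | x : H]; exists S.
have fS x : f x \in S by apply: imset_f.
exists (fun x => Sub (f x) (fS x) : {y : G | y \in S}); last first.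
  by move=> x y /=; rewrite -fadj.
apply: inj_card_bij => [x y /(congr1 val) /finj //|].
by rewrite card_sig (eq_card (fun z => erefl (z \in S))) card_imset ?cardE.
Qed.

Lemma itmP (H G : sgraph) :
  induced_topological_minor H G <->
  exists2 H' : sgraph, subdivision H H' & embeds H' G.
Proof. by split=> -[H' sub /induced_subgraphP emb]; exists H'. Qed.

(** An edge with an end outside the copy of [H'] is subdivided without changing that copy; an edge
    with both ends in the copy comes from an edge of [H'], which is subdivided as well. *)
Lemma subdivision_embeds (H H' K K' : sgraph) :
  subdivision H H' -> embeds H' K -> subdivision K K' ->
  exists2 H'' : sgraph, subdivision H H'' & embeds H'' K'.
Proof.
move=> subH embHK subK; elim: K' / subK => [|K' u v _ [L subL [f finj fadj]] uv].
  by exists H'.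
have [/codomP[u' Eu]|nu] := boolP (u \in codom f); last first.
  exists L => //; exists (Some \o f) => [x y [/finj]//|x y /=].
  rewrite fadj; case: eqVneq => [E|]; rewrite (andbT, andbF) //.
  have : u \in [set f x; f y] by rewrite E set21.
  by rewrite !inE => /orP[] /eqP E'; rewrite E' codom_f in nu.
have [/codomP[v' Ev]|nv] := boolP (v \in codom f); last first.
  exists L => //; exists (Some \o f) => [x y [/finj]//|x y /=].
  rewrite fadj; case: eqVneq => [E|]; rewrite (andbT, andbF) //.
  have : v \in [set f x; f y] by rewrite E set22.
  by rewrite !inE => /orP[] /eqP E'; rewrite E' codom_f in nv.
have uv' : adj u' v' by rewrite -fadj -Eu -Ev.
exists (subdivide_edge u' v'); first exact: subdivision_step.
exists (omap f); first by move=> [x|] [y|] //= [/finj->].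
move=> [x|] [y|] //=; last 2 first.
- by rewrite !inE Eu Ev !(inj_eq finj).
- by rewrite !inE Eu Ev !(inj_eq finj).
rewrite fadj; congr (_ && ~~ _).
have -> : [set f x; f y] = f @: [set x; y] by rewrite imsetU1 imset_set1.
have -> : [set u; v] = f @: [set u'; v'] by rewrite imsetU1 imset_set1 Eu Ev.
by rewrite (inj_eq (imset_inj finj)).
Qed.

Lemma itm_trans (G H K : sgraph) :
  induced_topological_minor H K -> induced_topological_minor K G ->
  induced_topological_minor H G.
Proof.
move=> /itmP[H' subH embH] /itmP[K' subK embK].
have [L subL embL] := subdivision_embeds subH embH subK.
by apply/itmP; exists L => //; apply: embeds_trans embK.
Qed.

Lemma embeds_itm (G H : sgraph) : embeds H G -> induced_topological_minor H G.
Proof. by move=> emb; apply/itmP; exists H => //; apply: subdivision_refl. Qed.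

Ltac bool_solve := rewrite -?andbA;
  repeat (match goal with
          | |- context [andb ?a _] =>
            lazymatch a with true => fail | false => fail | _ => case: a end
          end => //=); rewrite ?andbT ?andbF //.

(** * Induced paths, thetas and holes *)

Section Paths.
Variable G : sgraph.
Implicit Types (x y z v w : G) (s t c P Q D E : seq G) (Ps : seq (seq G)).

Definition nadj x y := (x != y) && ~~ adj x y.

Lemma nadj_sym x y : nadj x y = nadj y x.
Proof. by rewrite /nadj eq_sym adj_sym. Qed.

Lemma adj_neq x y : adj x y -> x != y.
Proof. by apply: contraTneq => ->; rewrite adj_irrefl. Qed.

(** Vertex sequences of induced paths. Since [nadj] includes distinctness, repetitions are excluded
    along with chords. *)
Fixpoint ipath s : bool :=
  if s is x :: t then
    (if t is y :: t' then adj x y && all (nadj x) t' else true) && ipath t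
  else true.

Definition anti s t := allrel nadj s t.
Arguments anti : simpl never.

Lemma antiC s t : anti s t = anti t s.
Proof. by rewrite /anti allrelC; apply: eq_allrel => x y; rewrite nadj_sym. Qed.

Lemma antiP s t : reflect {in s & t, forall x y, nadj x y} (anti s t).
Proof. exact: allrelP. Qed.

Lemma anti_revl s t : anti (rev s) t = anti s t.
Proof. by rewrite /anti /allrel all_rev. Qed.

Lemma anti_revr s t : anti s (rev t) = anti s t.
Proof. by rewrite antiC anti_revl antiC. Qed.

Lemma anti_catl s t u : anti (s ++ t) u = anti s u && anti t u.
Proof. exact: allrel_catl. Qed.

Lemma anti_catr s t u : anti u (s ++ t) = anti u s && anti u t.
Proof. exact: allrel_catr. Qed.

Lemma anti_consl x s t : anti (x :: s) t = all (nadj x) t && anti s t.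
Proof. exact: allrel_consl. Qed.

Lemma anti_consr x s t : anti s (x :: t) = all (nadj x) s && anti s t.
Proof. by rewrite antiC anti_consl antiC. Qed.

Lemma anti_nill s : anti [::] s. Proof. by []. Qed.
Lemma anti_nilr s : anti s [::]. Proof. by rewrite antiC. Qed.

Definition antiE := (anti_catl, anti_catr, anti_consl, anti_consr,
  anti_nill, anti_nilr, anti_revl, anti_revr).

Lemma ipath_glue s x t :
  ipath (s ++ x :: t) = [&& ipath (rcons s x), ipath (x :: t) & anti s t].
Proof.
elim: s => [|a s IH]; first by rewrite antiE andbT.
rewrite rcons_cons antiE; case: s IH => [|b s] /=.
  by move=> _; rewrite antiE !andbT; bool_solve.
by move=> ->; rewrite all_cat all_rcons /=; bool_solve.
Qed.

Lemma ipath_rcons2 s y z :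
  ipath (rcons (rcons s y) z) = [&& ipath (rcons s y), adj y z & all (nadj z) s].
Proof. by rewrite -cats1 cat_rcons ipath_glue !antiE /= !andbT. Qed.

Lemma ipath_catl s t : ipath (s ++ t) -> ipath s.
Proof.
case: t => [|x t]; first by rewrite cats0.
rewrite ipath_glue => /and3P[+ _ _].
by case/lastP: s => // s y; rewrite ipath_rcons2 => /and3P[].
Qed.

(** The ends are the only pair covered by neither shorter path; they are adjacent exactly when
    nothing lies between them. *)
Lemma ipath_cons_rcons x D y :
  ipath (x :: rcons D y) =
  [&& ipath (x :: D), ipath (rcons D y), x != y & adj x y == nilp D].
Proof.
case: D => [|d D].
  by case: eqVneq => [->|] /=; rewrite ?adj_irrefl ?eqb_id ?andbT ?andbF //.
have sub : ipath (rcons (d :: D) y) -> ipath (d :: D).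
  by rewrite -cats1 => /ipath_catl.
rewrite rcons_cons -[ipath (x :: d :: rcons _ _)]/([&& _ & ipath (rcons (d :: D) y)]).
rewrite -[ipath (x :: d :: D)]/([&& _ & ipath (d :: D)]) rcons_cons all_rcons eqbF_neg.
move: sub; rewrite rcons_cons {1}/nadj.
by case: (ipath _) => [->|_]; rewrite ?andbF //; bool_solve.
Qed.

Lemma ipath_rev s : ipath (rev s) = ipath s.
Proof.
elim: s => // x [|y s] IH //.
rewrite !rev_cons ipath_rcons2 -rev_cons IH /= all_rev adj_sym.
by rewrite [RHS]andbC -andbA.
Qed.

Lemma ipath_catr s t : ipath (s ++ t) -> ipath t.
Proof. by elim: s => //= x s IH /andP[_ /IH]. Qed.

Lemma ipath_uniq s : ipath s -> uniq s.
Proof.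
elim: s => // x [|y s] IH // /andP[/andP[xy /allP xs] /IH us].
rewrite cons_uniq us andbT inE negb_or adj_neq //=.
by apply/negP => /xs; rewrite /nadj eqxx.
Qed.

Lemma ipath_head x s : ipath (x :: s) -> x \notin s.
Proof. by move=> /ipath_uniq /andP[]. Qed.

(** Interior of a path from [x] to [y] that is induced up to a possible edge [xy], which [theta]
    controls for all ears at once. *)
Definition ear x y P := ipath (x :: P) && ipath (rcons P y).

Lemma ear_rev x y P : ear y x (rev P) = ear x y P.
Proof.
rewrite /ear -(ipath_rev (y :: _)) rev_cons revK andbC.
by rewrite -(ipath_rev (rcons _ _)) rev_rcons revK.
Qed.

(** Two ears, not both empty, describe an induced cycle. Three ears of sizes 0, 1, 2 form the house,
    of sizes 0, 1, 1 the diamond, and of sizes 1, 1, 1 the graph $K_{2,3}$. *)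
Definition theta x y Ps :=
  [&& x != y, adj x y == has (@nilp _) Ps, all (ear x y) Ps & pairwise anti Ps].

Lemma theta2E x y P Q :
  theta x y [:: P; Q] =
  [&& x != y, adj x y == nilp P || nilp Q, ear x y P, ear x y Q & anti P Q].
Proof. by rewrite /theta /= !andbT !orbF -!andbA. Qed.

Lemma theta3E x y P Q R :
  theta x y [:: P; Q; R] =
  [&& x != y, adj x y == [|| nilp P, nilp Q | nilp R],
      ear x y P, ear x y Q, ear x y R, anti P Q, anti P R & anti Q R].
Proof. by rewrite /theta /= !andbT !orbF -!andbA. Qed.

Lemma theta2C x y P Q : theta x y [:: P; Q] = theta x y [:: Q; P].
Proof. by rewrite !theta2E orbC antiC; bool_solve. Qed.

Lemma theta2_rev x y P Q : theta y x [:: rev P; rev Q] = theta x y [:: P; Q].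
Proof.
by rewrite !theta2E !ear_rev !antiE eq_sym adj_sym /nilp !size_rev.
Qed.

Lemma theta3_swap12 x y P Q R :
  theta x y [:: P; Q; R] -> theta x y [:: Q; P; R].
Proof.
rewrite !theta3E => /and5P[-> /eqP-> -> -> /and4P[-> + -> ->]].
by rewrite antiC => ->; rewrite orbCA eqxx.
Qed.

Lemma theta3_swap23 x y P Q R :
  theta x y [:: P; Q; R] -> theta x y [:: P; R; Q].
Proof.
rewrite !theta3E => /and5P[-> /eqP-> -> -> /and4P[-> -> -> +]].
by rewrite antiC => ->; rewrite [nilp R || _]orbC eqxx.
Qed.

Let theta_shift_imp x y z D E :
  theta x y [:: D; rcons E z] -> theta x z [:: rcons D y; E].
Proof.
rewrite !theta2E => /and5P[xy /eqP axy /andP[xD Dy] /andP[xEz Ezy]].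
rewrite -cats1 !antiE => /and3P[DE zD _].
move: (xEz) Ezy; rewrite ipath_rcons2 ipath_cons_rcons.
move=> /and4P[xE Ez xz /eqP axz] /and3P[_ zy yE].
rewrite xz axz /nilp size_rcons /= eqxx /ear xE Ez ipath_cons_rcons xD Dy xy axy.
rewrite /nilp size_rcons orbF eqxx /= ipath_rcons2 Dy adj_sym zy zD.
by rewrite -cats1 !antiE DE yE.
Qed.

(** Two ears bound a cycle, so the second base vertex may slide along it. *)
Lemma theta_shift x y z D E :
  theta x y [:: D; rcons E z] = theta x z [:: rcons D y; E].
Proof.
apply/idP/idP => [/theta_shift_imp //|].
by rewrite theta2C => /theta_shift_imp; rewrite theta2C.
Qed.

(** Holes, that is, induced cycles of length at least 4, seen as thetas on the edge between the
    first and the last vertex. *)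
Definition icycle c :=
  if c is x :: h :: t then
    (1 < size t) && theta x (last h t) [:: [::]; belast h t]
  else false.

Lemma icycle_rcons x D l :
  icycle (x :: rcons D l) = (1 < size D) && theta x l [:: [::]; D].
Proof. by case: D => [|h D] //=; rewrite size_rcons last_rcons belast_rcons. Qed.

(** Any other vertex can serve as second base point, by repeated [theta_shift]. The arc [E] is read
    backwards, starting from [x]. *)
Lemma icycle_split x D y E :
  icycle (x :: D ++ y :: E) = (1 < size D + size E) && theta x y [:: D; rev E].
Proof.
elim: E D y => [|z E IH] D y.
  by rewrite cats1 icycle_rcons theta2C addn0.
rewrite -cat_rcons IH rev_cons theta_shift size_rcons /= addSn addnS //.
Qed.

Lemma icycle_rot n c : icycle (rot n c) = icycle c.
Proof.
rewrite /rot -{3}(cat_take_drop n c).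
case: (drop n c) (take n c) => [|y E] [|x D]; rewrite ?cats0 //.
rewrite !icycle_split addnC; congr (_ && _).
by rewrite -theta2_rev theta2C revK.
Qed.

Lemma icycle_uniq c : icycle c -> uniq c.
Proof.
case: c => // x [|h t] // /andP[_].
rewrite theta2E => /and5P[xl _ _ /andP[xP Py] _].
rewrite cons_uniq lastI (ipath_uniq Py) mem_rcons inE (negPf xl) /=.
by rewrite (ipath_head xP).
Qed.

End Paths.
Arguments icycle : simpl never.
Arguments theta : simpl never.
Arguments anti : simpl never.

Section MapPath.
Variables (G G' : sgraph) (f : G -> G').

Lemma ipath_map (s : seq G) :
  {in s &, injective f} -> {in s &, forall x y, adj (f x) (f y) = adj x y} ->
  ipath (map f s) = ipath s.
Proof.
elim: s => // x s IH finj fadj /=.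
rewrite IH; last 2 first.
- by move=> y z ys zs; apply: finj; rewrite inE ?ys ?zs orbT.
- by move=> y z ys zs; apply: fadj; rewrite inE ?ys ?zs orbT.
congr (_ && _); case: s IH finj fadj => // y s _ finj fadj /=.
rewrite fadj ?inE ?eqxx ?orbT //; congr (_ && _).
rewrite all_map; apply: eq_in_all => z zs /=.
have zs' : z \in [:: x, y & s] by rewrite !inE zs !orbT.
rewrite /nadj fadj ?mem_head // (inj_in_eq finj) ?mem_head //.
Qed.

Lemma anti_map (s t : seq G) :
  {in s & t, forall x y, nadj (f x) (f y) = nadj x y} ->
  anti (map f s) (map f t) = anti s t.
Proof.
move=> H; rewrite /anti /allrel all_map; apply: eq_in_all => x xs /=.
by rewrite all_map; apply: eq_in_all => y yt /=; apply: H.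
Qed.

Lemma icycle_map (c : seq G) :
  {in c &, injective f} -> {in c &, forall x y, adj (f x) (f y) = adj x y} ->
  icycle (map f c) = icycle c.
Proof.
case: c => // x [|h t] // finj fadj.
rewrite [map _ _]/= /icycle last_map belast_map size_map !theta2E.
have sub : {subset x :: belast h t <= [:: x, h & t]}.
  move=> z; rewrite inE => /orP[/eqP->|/mem_belast zt]; first exact: mem_head.
  by rewrite inE zt orbT.
have sub' : {subset h :: t <= [:: x, h & t]}.
  by move=> z zt; rewrite inE zt orbT.
have lc : last h t \in [:: x, h & t] by apply/sub'/mem_last.
congr (_ && _); rewrite (inj_in_eq finj) ?mem_head // fadj ?mem_head //.
congr [&& _, _, _, _ & _].
rewrite /ear -map_rcons -map_cons -lastI !ipath_map //.
- by move=> y z /sub' ys /sub' zs; apply: finj.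
- by move=> y z /sub' ys /sub' zs; apply: fadj.
- by move=> y z /sub ys /sub zs; apply: finj.
- by move=> y z /sub ys /sub zs; apply: fadj.
Qed.

End MapPath.

(** * Subdivisions of the house are thetas *)

Section AddEdge.
Variables (G : sgraph) (u v : G).

(** Serves to suppress a vertex of degree 2 by joining its neighbours [u] and [v]. The guard
    [u != v] keeps the relation irreflexive. *)
Definition add_edge_adj : rel G := fun a b =>
  adj a b || ((u != v) && ([set a; b] == [set u; v])).

Lemma add_edge_sym : symmetric add_edge_adj.
Proof. by move=> a b; rewrite /add_edge_adj adj_sym setUC. Qed.

Lemma add_edge_irrefl : irreflexive add_edge_adj.
Proof.
move=> a; rewrite /add_edge_adj adj_irrefl /=; apply/negP => /andP[uv /eqP E].
have : (u \in [set a; a]) && (v \in [set a; a]) by rewrite E !inE !eqxx orbT.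
by rewrite !inE !orbb => /andP[/eqP eu /eqP ev]; rewrite eu ev eqxx in uv.
Qed.

Definition add_edge : sgraph := SGraph add_edge_sym add_edge_irrefl.

Lemma add_edge_adjE (a b : G) :
  (a \notin [:: u; v]) || (b \notin [:: u; v]) || (a == b) ->
  @adj add_edge a b = @adj G a b.
Proof.
move=> H /=; rewrite /add_edge_adj; case E: (_ && _); last by rewrite orbF.
case/andP: E => uv /eqP E; exfalso.
have : (a \in [set u; v]) && (b \in [set u; v]) by rewrite -E !inE !eqxx orbT.
move: H; rewrite !inE => /orP[/orP[]|/eqP ab]; rewrite ?negb_or.
- by case/andP=> /negPf-> /negPf->.
- by case/andP=> /negPf-> /negPf->; rewrite andbF.
have : (u \in [set a; b]) && (v \in [set a; b]) by rewrite E !inE !eqxx orbT.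
by rewrite ab !inE !orbb => /andP[/eqP eu /eqP ev]; rewrite eu ev eqxx in uv.
Qed.

Lemma add_edge_in (s : seq G) : (u \notin s) || (v \notin s) ->
  {in s &, forall a b : G, @adj add_edge a b = @adj G a b}.
Proof.
move=> H a b sa sb; rewrite add_edge_adjE // !inE !negb_or.
have [au|_] /= := eqVneq a u; last first.
  have [av|//] := eqVneq a v; have [bv|bv] := eqVneq b v.
    by rewrite av bv eqxx orbT.
  have [bu|//] := eqVneq b u.
  by move: H; rewrite -av -bu sa sb.
have [bu|_] := eqVneq b u; first by rewrite au bu eqxx orbT.
have [bv|//] := eqVneq b v.
by move: H; rewrite -au -bv sa sb.
Qed.

End AddEdge.

(* [V] is exactly the vertex set of an induced subdivision of the house. *)
Definition house_on (G : sgraph) (V : seq G) : Prop :=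
  exists2 K : sgraph, subdivision house K &
  exists f : K -> G, [/\ injective f, forall x y, adj (f x) (f y) = adj x y
                      & codom f =i V].

Lemma house_on_eq (G : sgraph) (V V' : seq G) :
  V =i V' -> house_on V -> house_on V'.
Proof.
move=> E [K sub [f [finj fadj fV]]]; exists K => //; exists f; split=> // z.
by rewrite fV E.
Qed.

(** Undoes the suppression of [w]: the added edge is subdivided in the subdivision of the house, and
    the new vertex is sent to [w]. *)
Lemma house_on_subdivide (G : sgraph) (u v w : G) (V : seq G) :
  u != v -> adj w u -> adj w v -> ~~ adj u v ->
  w \notin V -> u \in V -> v \in V ->
  {in V, forall z, adj w z -> z \in [:: u; v]} ->
  @house_on (add_edge u v) V -> house_on (w :: V).
Proof.
move=> uv wu wv nuv wV uV vV wN [K sub [f [finj fadj fV]]].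
have /codomP[u' Eu] : u \in codom f by rewrite fV.
have /codomP[v' Ev] : v \in codom f by rewrite fV.
have uv' : adj u' v' by rewrite -fadj -Eu -Ev /= /add_edge_adj uv eqxx orbT.
exists (subdivide_edge u' v'); first exact: subdivision_step.
have fw x : w == f x = false.
  by apply: contraNF wV => /eqP->; rewrite -fV codom_f.
have wf x : adj w (f x) = (x \in [set u'; v']).
  apply/idP/idP => [/wN|]; last first.
    by rewrite !inE => /orP[] /eqP->; rewrite -?Eu -?Ev.
  rewrite -fV codom_f => /(_ isT); rewrite !inE.
  by rewrite {1}Eu {1}Ev !(inj_eq finj).
exists (fun x => if x is Some x then f x else w); split.
- move=> [x|] [y|] //; first by move/finj->.
  + by move=> /esym/eqP; rewrite fw.
  + by move=> /eqP; rewrite fw.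
- move=> [x|] [y|] /=; rewrite ?adj_irrefl ?wf //; last by rewrite adj_sym wf.
  rewrite -fadj /= /add_edge_adj uv /=.
  have -> : ([set f x; f y] == [set u; v]) = ([set x; y] == [set u'; v']).
    have -> : [set f x; f y] = f @: [set x; y] by rewrite imsetU1 imset_set1.
    have -> : [set u; v] = f @: [set u'; v'] by rewrite imsetU1 imset_set1 Eu Ev.
    by rewrite (inj_eq (imset_inj finj)).
  case: eqVneq => [E|_]; last by rewrite orbF andbT.
  rewrite andbF; apply/negP => fxy.
  have : (f x \in [set u; v]) && (f y \in [set u; v]).
    rewrite Eu Ev !inE !(inj_eq finj).
    have : (x \in [set u'; v']) && (y \in [set u'; v']) by rewrite -E !inE !eqxx orbT.
    by rewrite !inE.
  rewrite !inE => /andP[/orP[] /eqP ex /orP[] /eqP ey]; move: fxy.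
  + by rewrite ex ey adj_irrefl.
  + by rewrite ex ey (negPf nuv).
  + by rewrite ex ey adj_sym (negPf nuv).
  + by rewrite ex ey adj_irrefl.
- move=> z; rewrite inE -fV; apply/codomP/orP.
    by case=> -[x|] ->; [right; apply: codom_f|left].
  by case=> [/eqP->|/codomP[x ->]]; [exists None|exists (Some x)].
Qed.

(** The first interior vertex [w] of an ear has degree 2 in the theta and can be suppressed, unless
    this would create a second edge [xy]. Its second neighbour [h] is [y] itself when [P] is
    empty. *)
Lemma theta_suppress (G : sgraph) (x y w : G) (P : seq G) (Ps : seq (seq G)) :
  theta x y ((w :: P) :: Ps) -> ~~ (nilp P && has (@nilp _) Ps) ->
  let h := head y P in let V := [:: x, y & P ++ flatten Ps] in
  [/\ x != h, adj w x, adj w h, ~~ adj x h & [/\ w \notin V,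
      {in V, forall z, adj w z -> z \in [:: x; h]} &
      @theta (add_edge x h) x y (P :: Ps)]].
Proof.
move=> th nnil h V; case/and4P: th => xy /eqP axy.
move=> /andP[/andP[xwP wPy] /allP ears] /andP[/allP antiwP pws].
have /andP[/andP[xw xP] wP] : adj x w && all (nadj x) P && ipath (w :: P) := xwP.
have {}axy : adj x y = has (@nilp _) Ps := axy.
have Py : ipath (rcons P y) by move: wPy; rewrite /= => /andP[].
have wh : adj w h by move: wPy; rewrite /h; case: (P) => [|a P'] /andP[/andP[]].
have h0 : nilp P -> h = y by move=> /nilP P0; rewrite /h P0.
have hP : ~~ nilp P -> P = h :: behead P by rewrite /h; case: (P).
have xh : x != h.
  by rewrite /h; case: (P) xP => //= a P' /andP[/andP[]].
have nxh : ~~ adj x h.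
  rewrite /h; case: (P) xP nnil => [|a P'] /=; last by case/andP=> /andP[].
  by rewrite axy.
have nwy : ~~ nilp P -> nadj w y.
  case: (P) wPy => [|a P'] //= /andP[/andP[_ +] _] _.
  by rewrite all_rcons => /andP[].
have nwP z : z \in P -> nadj w z || (z == h).
  rewrite /h; case: (P) wPy => [|a P'] //= /andP[/andP[_ +] _].
  rewrite all_rcons inE => /andP[_ /allP H] /orP[->|/H->] //.
  by rewrite orbT.
have nwPs z Q : Q \in Ps -> z \in Q -> nadj w z.
  by move=> /antiwP; rewrite antiE => /andP[/allP H _] /H.
have xnP : x \notin P by apply/negP => /(allP xP); rewrite /nadj eqxx.
have wnP : w \notin P by move: (ipath_uniq wPy); rewrite /= mem_rcons inE negb_or => /andP[/andP[]].
have wy : w != y by move: (ipath_uniq wPy); rewrite /= mem_rcons inE negb_or => /andP[/andP[]].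
have xQ Q : Q \in Ps -> x \notin Q by move=> /ears/andP[/ipath_head].
have yQ Q : Q \in Ps -> y \notin Q.
  by move=> /ears/andP[_ /ipath_uniq]; rewrite rcons_uniq => /andP[].
have hQ Q : Q \in Ps -> h \notin Q.
  move=> QPs; rewrite /h; case: (P) antiwP => [_|a P' antiwP] /=; first exact: yQ.
  apply/negP => aQ; have := antiwP _ QPs.
  by rewrite !antiE => /and3P[_ /allP/(_ _ aQ)]; rewrite /nadj eqxx.
have ipath_add (s : seq G) : (x \notin s) || (h \notin s) ->
    @ipath (add_edge x h) s = ipath s.
  move=> H; rewrite -[in LHS](map_id s).
  by apply: (@ipath_map G (add_edge x h) id) => //; apply: add_edge_in.
have anti_add (s t : seq G) : x \notin s -> x \notin t ->
    @anti (add_edge x h) s t = anti s t.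
  move=> xs xt; rewrite -[in LHS](map_id s) -[in LHS](map_id t).
  apply: (@anti_map G (add_edge x h) id) => // a b sa tb.
  rewrite /nadj; congr (_ && ~~ _); apply: (@add_edge_in _ x h (s ++ t)).
  - by rewrite mem_cat negb_or xs xt.
  - by rewrite mem_cat sa.
  - by rewrite mem_cat tb orbT.
split=> //; first by rewrite adj_sym.
split.
- rewrite !inE !negb_or wy mem_cat negb_or wnP eq_sym adj_neq //=.
  apply/negP => /flattenP[Q QPs wQ].
  by have := nwPs _ _ QPs wQ; rewrite /nadj eqxx.
- move=> z; rewrite !inE mem_cat => /or4P[/eqP->|/eqP->|zP|/flattenP[Q QPs zQ]] wz.
  + by rewrite eqxx.
  + rewrite /h; case: (P) nwy => [|a P' /(_ isT)]; first by rewrite eqxx orbT.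
    by rewrite /nadj wz andbF.
  + by have := nwP _ zP; rewrite /nadj wz andbF /= => ->; rewrite orbT.
  + by have := nwPs _ _ QPs zQ; rewrite /nadj wz andbF.
apply/and4P; split=> //.
- rewrite /= /add_edge_adj axy xh; have [P0|Pn] /= := boolP (nilp P).
    by rewrite (h0 P0) eqxx orbT.
  case: ([set x; y] =P _) => [E|_]; last by rewrite orbF.
  exfalso; have : y \in [set x; h] by rewrite -E set22.
  rewrite !inE eq_sym (negPf xy) => /eqP yh.
  by have := nwy Pn; rewrite /nadj yh wh andbF.
- apply/andP; split; last first.
    apply/allP => Q QPs; have /andP[xQi Qyi] := ears _ QPs.
    rewrite /ear !ipath_add ?xQi //.
      by rewrite mem_rcons inE negb_or xy xQ.
    have : h \notin x :: Q by rewrite inE negb_or eq_sym xh hQ.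
    by move=> ->; rewrite orbT.
  rewrite /ear [X in _ && X]ipath_add; last by rewrite mem_rcons inE negb_or xy xnP.
  rewrite Py andbT; have [/nilP->//|Pn] := boolP (nilp P).
  have EP := hP Pn; set P' := behead P in EP.
  have xP' z : z \in P' -> (x != z) && ~~ adj x z.
    by move=> zP; apply: (allP xP); rewrite EP inE zP orbT.
  have hP' : h \notin P' by move: (ipath_uniq Py); rewrite EP /= mem_rcons inE negb_or => /andP[/andP[]].
  have iP : @ipath (add_edge x h) P.
    rewrite ipath_add ?xnP //.
    by move: wP; rewrite /= => /andP[].
  rewrite EP in iP *.
  rewrite -[ipath _]/([&& (_ && all _ _) & ipath (h :: P' : seq (add_edge x h))]).
  rewrite iP andbT /= /add_edge_adj xh eqxx orbT /=; apply/allP => z zP.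
  have /andP[xz nxz] := xP' _ zP.
  rewrite /nadj xz /= /add_edge_adj (negPf nxz) xh /=.
  apply/eqP => E; have : z \in [set x; h] by rewrite -E set22.
  rewrite !inE eq_sym (negPf xz) => /eqP zh.
  by rewrite -zh zP in hP'.
apply/andP; split.
  apply/allP => Q QPs; rewrite anti_add //; last exact: xQ.
  by have := antiwP _ QPs; rewrite antiE => /andP[].
have sub : {in Ps &, subrel (@anti G) (@anti (add_edge x h))}.
  by move=> S T SPs TPs; rewrite anti_add ?xQ.
by apply: (sub_in_pairwise sub) pws; apply/allP.
Qed.

(** Suppressing interior vertices one at a time shrinks the ears to sizes 0, 1 and 2, which is the
    house; [house_on_subdivide] then restores them. *)
Lemma theta_house (G : sgraph) (x y : G) (P Q R : seq G) :
  theta x y [:: P; Q; R] -> 0 < size Q -> 1 < size R ->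
  house_on [:: x, y & P ++ Q ++ R].
Proof.
have [n] := ubnP (size P + size Q + size R).
elim: n => // n IH in G x y P Q R *; rewrite ltnS => szn th szQ szR.
have nilQ : ~~ nilp Q by rewrite /nilp -lt0n.
have szR0 : 0 < size R by apply: ltnW.
have nilR : ~~ nilp R by rewrite /nilp -lt0n ltnW.
case: P => [|w P] in th szn *; last first.
  have nnil : ~~ (nilp P && has (@nilp _) [:: Q; R]).
    by rewrite /= (negPf nilQ) (negPf nilR) andbF.
  have [xh wx wh nxh []] := theta_suppress th nnil; rewrite /= cats0.
  move=> wV wN th'; apply: (@house_on_eq _ (w :: [:: x, y & P ++ Q ++ R])).
    by move=> z; rewrite !inE orbCA; congr (_ || _); rewrite orbCA.
  apply: (house_on_subdivide xh) => //.
  - by rewrite mem_head.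
  - case: (P) => [|a P']; first by rewrite !inE eqxx orbT.
    by rewrite !inE /= eqxx !orbT.
  - exact: IH.
(* One suppression beside an empty ear. The continuation ranges over all graphs because the
   suppression changes the graph. *)
have mid (S T : seq G) : theta x y [:: S; [::]; T] -> 1 < size S -> 0 < size T ->
    size S + size T <= n ->
    (forall G' (S' T' : seq (vertex G')) x' y', theta x' y' [:: S'; [::]; T'] -> size S' = (size S).-1 ->
      size T' = size T ->
      house_on [:: x', y' & S' ++ T']) ->
    house_on [:: x, y & S ++ T].
  case: S => [|w S] // th1 szS szT lt IH'.
  have nnil : ~~ (nilp S && has (@nilp _) [:: [::]; T]).
    by rewrite /nilp; case: (S) szS.
  have [xh wx wh nxh []] := theta_suppress th1 nnil; rewrite /= cats0.
  move=> wV wN th'; apply: (@house_on_eq _ (w :: [:: x, y & S ++ T])).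
    by move=> z; rewrite !inE orbCA; congr (_ || _); rewrite orbCA.
  apply: (house_on_subdivide xh) => //.
  - by rewrite mem_head.
  - by case: (S) szS => // a S' _; rewrite !inE /= eqxx !orbT.
  - exact: IH'.
have [szQ2|szQ1] := ltnP 1 (size Q).
  apply: (mid Q R) => //; first exact: theta3_swap12.
  move=> G' S' T' x' y' th' szS szT; apply: (IH G' x' y' [::]) => //.
  - by rewrite /= szS szT; case: (Q) szQ szn.
  - exact: theta3_swap12.
  - by rewrite szS -ltnS prednK.
  - by rewrite szT.
have [szR3|szR2] := ltnP 2 (size R).
  apply: (@house_on_eq _ [:: x, y & R ++ Q]).
    by move=> z; rewrite !inE !mem_cat [(z \in R) || _]orbC.
  apply: (mid R Q) => //.
  - exact/theta3_swap12/theta3_swap23.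
  - by rewrite addnC.
  move=> G' S' T' x' y' th' szS szT.
  apply: (@house_on_eq _ [:: x', y' & T' ++ S']).
    by move=> z; rewrite !inE !mem_cat [(z \in S') || _]orbC.
  apply: (IH G' x' y' [::]) => //.
  - by rewrite /= szS szT addnC; case: (R) szR szn => // a l; rewrite addnC.
  - exact/theta3_swap23/theta3_swap12.
  - by rewrite szT.
  - by rewrite szS -ltnS prednK // ltnW.
case: Q szQ szQ1 th {szn nilQ mid} => [|p [|? ?]] // _ _.
case: R szR szR2 {nilR szR0} => [|q [|r [|? ?]]] // _ _ th.
move: th; rewrite theta3E /ear !antiE /= !andbT -!andbA.
move=> /and5P[xy /eqP axy xp py /and5P[xq xr nxr qr /and5P[_ qy nqy ry /and3P[pq npq pr]]]].
exists house; first exact: subdivision_refl.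
(* The order follows the labels of [house]: the 4-cycle [x q r y], then the top [p] of the
   triangle. *)
pose s := [:: x; q; r; y; p].
have us : uniq s.
  rewrite /= !inE !negb_or !(adj_neq xq) (adj_neq xp) xy (adj_neq qr) (adj_neq ry).
  have /andP[pr' _] := pr.
  by rewrite xr qy (eq_sym q) pq (eq_sym r) pr' (eq_sym y) adj_neq.
exists (fun i : house => nth x s (nat_of_ord (i : 'I_5))); split.
- by move=> i j /eqP; rewrite nth_uniq ?ltn_ord // => /eqP/val_inj.
- move: nxr nqy npq pr => /negPf{}xr /negPf{}qy /negPf{}pq /andP[_ /negPf{}pr].
  case=> [[|[|[|[|[|//]]]]] ?] [[|[|[|[|[|//]]]]] ?];
  rewrite /= ?adj_irrefl ?xr ?qy ?pq ?pr ?axy ?xp ?py ?xq ?qr ?ry //;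
  by rewrite adj_sym ?xr ?qy ?pq ?pr ?axy ?xp ?py ?xq ?qr ?ry.
- move=> z; apply/codomP/idP.
    by case=> -[[|[|[|[|[|//]]]]] ?] ->; rewrite !inE eqxx ?orbT.
  rewrite !inE => /or4P[/eqP->|/eqP->|/eqP->|/orP[]/eqP->].
  + by exists (inord 0); rewrite inordK.
  + by exists (inord 3); rewrite inordK.
  + by exists (inord 4); rewrite inordK.
  + by exists (inord 1); rewrite inordK.
  + by exists (inord 2); rewrite inordK.
Qed.

Lemma house_free_theta (G : sgraph) (x y : G) (P Q R : seq G) :
  induced_subdivision_free house G ->
  theta x y [:: P; Q; R] -> 0 < size Q -> 1 < size R -> False.
Proof.
move=> free th szQ szR; apply: free; apply/itmP.
have [K sub [f [finj fadj _]]] := theta_house th szQ szR.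
by exists K => //; exists f.
Qed.

(** * Attachments to holes *)

Lemma has_split_first (T : Type) (p : pred T) (s : seq T) :
  has p s -> exists s1 x s2, [/\ s = s1 ++ x :: s2, p x & ~~ has p s1].
Proof.
by case/split_find => x s1 s2 px ns1; exists s1, x, s2; rewrite cat_rcons.
Qed.

Lemma has_split_last (T : Type) (p : pred T) (s : seq T) :
  has p s -> exists s1 x s2, [/\ s = s1 ++ x :: s2, p x & ~~ has p s2].
Proof.
rewrite -has_rev => /has_split_first[s1 [x [s2 [E px ns1]]]].
exists (rev s2), x, (rev s1); rewrite has_rev; split=> //.
by rewrite -(revK s) E rev_cat rev_cons cat_rcons.
Qed.

Ltac cat_norm := rewrite -?cats1 ?cat_cons /= -?catA /= -?catA /=.

Section Hole.
Variable G : sgraph.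
Hypothesis house_free : induced_subdivision_free house G.
Implicit Types (x y z v w t : G) (c P Q D E R : seq G).

Lemma icycle_ipath x s : icycle (x :: s) -> ipath s.
Proof.
case/lastP: s => // s y; rewrite icycle_rcons theta2E.
by move=> /andP[_ /and5P[_ _ _ /andP[]]].
Qed.

Lemma icycle_cat (s t : seq G) : icycle (s ++ t) = icycle (t ++ s).
Proof. by rewrite -(rot_size_cat s t) icycle_rot. Qed.

Lemma all_nadj v s : v \notin s -> ~~ has (adj v) s -> all (nadj v) s.
Proof.
move=> vs /hasPn H; apply/allP => z zs; rewrite /nadj H // andbT.
by apply: contraNneq vs => ->.
Qed.

Lemma ipath_cons_head v x s : ipath (v :: x :: s) = [&& adj v x, all (nadj v) s & ipath (x :: s)].
Proof. by rewrite /= -andbA. Qed.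

Definition twin c v z := {in c, forall y, adj v y = (y == z) || adj z y}.

(** [D] is a gap between two neighbours of [v]. Every position of the other neighbours yields a
    forbidden theta, except when [E] is a single vertex seen by [v]: then [v] is a twin of that
    vertex. *)
Lemma hole_attach_gap x D y E v :
  icycle (x :: D ++ y :: E) -> 2 < size D + size E ->
  v \notin x :: D ++ y :: E -> adj v x -> adj v y ->
  ~~ nilp D -> ~~ has (adj v) D ->
  count (adj v) (x :: D ++ y :: E) = 3 /\
  exists2 z, z \in x :: D ++ y :: E & twin (x :: D ++ y :: E) v z.
Proof.
move=> cyc sz; rewrite inE mem_cat inE !negb_or => /and4P[vx vD vy vE] avx avy.
move=> Dnil hD; have nD := all_nadj vD hD.
have xvD : ipath (v :: x :: D).
  rewrite ipath_cons_head avx nD /=.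
  move: cyc; rewrite -cat_cons icycle_cat /= => /icycle_ipath.
  by apply: ipath_catr.
have xDy : ipath (rcons (x :: D) y) \/ E = [::].
  case/lastP: E {sz vE} cyc => [|E e] cyc; [by right|left].
  have /icycle_ipath/ipath_catl // : icycle ([:: e] ++ (rcons (x :: D) y ++ E)).
  by rewrite icycle_cat; move: cyc; cat_norm.
have [hE|hE] := boolP (has (adj v) E); last first.
  exfalso; have nE := all_nadj vE hE.
  move: cyc; rewrite icycle_split theta2E.
  move=> /andP[_ /and5P[xy /eqP axy exD exE aDE]].
  have ev : ear x y [:: v] by rewrite /ear /= avy adj_sym avx.
  have aDv : anti D [:: v] by rewrite antiC !antiE nD.
  have aEv : anti (rev E) [:: v] by rewrite antiC !antiE all_rev nE.
  (* [v] gives a third path from [x] to [y]. Since the hole has length at least 5, one of its two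
     arcs has at least two interior vertices. *)
  have th : theta x y [:: D; rev E; [:: v]].
    by rewrite theta3E xy axy orbF eqxx exD exE ev aDE aDv aEv.
  have [D1|D1] := ltnP 1 (size D).
    exact: (house_free_theta house_free (theta3_swap23 (theta3_swap12 th))).
  apply: (house_free_theta house_free (theta3_swap23 th)) => //.
  by rewrite size_rev; case: (size D) D1 sz => [|[|?]] // _; rewrite ?addSn; case: (size E) => [|[|[|?]]].
have [E1 [z [E2 [EE avz hE1]]]] := has_split_first hE.
move: vE xDy; rewrite {}EE in cyc sz hE *; rewrite mem_cat inE !negb_or => /and3P[vE1 vz vE2].
have nE1 := all_nadj vE1 hE1.
case=> [xDy|]; last by case: (E1).
have yE1z : ipath (rcons (y :: E1) z).
  move: cyc => /icycle_ipath; rewrite -[in rcons _ _]/(y :: rcons E1 z).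
  by move/ipath_catr; rewrite -cat_cons -cat_rcons => /ipath_catl.
have zE1y : ipath (rcons (z :: rev E1) y).
  by rewrite -ipath_rev rev_rcons rev_cons revK -rcons_cons.
have [E20|E2n] := boolP (nilp E2); last first.
  exfalso; have xDE1z : ipath (x :: D ++ y :: rcons E1 z).
    case/lastP: E2 {sz vE2 hE} cyc E2n => // E2 e cyc _.
    have /icycle_ipath/ipath_catl // : icycle ([:: e] ++ ((x :: D ++ y :: rcons E1 z) ++ E2)).
    by rewrite icycle_cat; move: cyc; cat_norm.
  have xDaE1z : anti (x :: D) (rcons E1 z) by move: xDE1z; rewrite -cat_cons ipath_glue => /and3P[].
  have azD : anti (z :: rev E1) (x :: D).
    apply/antiP => s t; rewrite inE mem_rev => szE txD; rewrite nadj_sym.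
    by apply: (antiP _ _ xDaE1z) => //; rewrite mem_rcons inE.
  (* Base points are [v] and its neighbour [y]; a nonempty [E2] keeps [x] and [z] nonadjacent. *)
  have th : theta v y [:: [::]; z :: rev E1; x :: D].
    rewrite theta3E vy avy /= /ear xvD xDy zE1y ipath_cons_head avz all_rev nE1.
    move: zE1y; rewrite -cats1 => /ipath_catl ->.
    by rewrite azD.
  by apply: (house_free_theta house_free th) => //=; case: (D) Dnil.
move/nilP: E20 => E20; rewrite {}E20 in cyc sz hE vE2 *.
have ax : adj z x /\ all (nadj x) (y :: E1).
  case/lastP: D Dnil {nD vD hD xvD xDy sz} cyc => // D d _ cyc.
  have /icycle_ipath H : icycle (d :: ((y :: E1) ++ z :: x :: D)).
    rewrite -cat_rcons -(cat_cons d) icycle_cat; by move: cyc; cat_norm.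
  split.
    by have := ipath_catr H; rewrite ipath_cons_head => /and3P[].
  by move: H; rewrite ipath_glue antiC anti_consl => /and4P[].
case: ax => azx xnE.
have xz : adj x z by rewrite adj_sym.
case: (boolP (nilp E1)) => [/nilP E10|E1n]; last first.
  exfalso; have e1 : ear v z [:: x] by rewrite /ear /= avx xz.
  have e2 : ear v z (y :: E1).
    rewrite /ear yE1z ipath_cons_head avy nE1.
    by move: yE1z; rewrite -cats1 => /ipath_catl ->.
  (* Now [x] is a common neighbour of the adjacent vertices [v] and [z], and [E1] makes the third
     ear long. *)
  have th : theta v z [:: [::]; [:: x]; y :: E1].
    by rewrite theta3E vz avz e1 e2 !anti_nill anti_consl xnE anti_nill.
  by apply: (house_free_theta house_free th) => //=; case: (E1) E1n.
rewrite {}E10 /= in cyc sz hE xnE yE1z *; rewrite avx count_cat /= avy avz.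
split; first by move: hD; rewrite has_count -leqNgt leqn0 => /eqP ->.
exists z; first by rewrite inE mem_cat !inE eqxx !orbT.
have : icycle ([:: z] ++ rcons (x :: D) y) by rewrite icycle_cat; move: cyc; cat_norm.
rewrite cat1s icycle_rcons theta2E.
move=> /andP[_ /and5P[zy azy _ /andP[zxD _] _]].
move=> t; rewrite inE mem_cat !inE => /or4P[/eqP->|tD|/eqP->|/eqP->].
- by rewrite avx azx orbT.
- have /negPf-> : ~~ adj v t by have := allP nD _ tD => /andP[].
  move: zxD; rewrite ipath_cons_head => /and3P[_ /allP/(_ _ tD)/andP[zt /negPf ->] _].
  by rewrite eq_sym (negPf zt).
- by rewrite avy (eqP azy) orbT.
- by rewrite avz eqxx.
Qed.

(** Around a vertex [a] missed by [v], the nearest neighbours of [v] in the two directions bound a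
    gap; they are distinct once [v] has two neighbours on the hole. *)
Lemma hole_attach c v : icycle c -> 4 < size c -> v \notin c ->
  [\/ count (adj v) c <= 1, all (adj v) c |
      count (adj v) c = 3 /\ exists2 z, z \in c & twin c v z].
Proof.
move=> cyc sz vc; case: leqP => cnt; first exact: Or31.
have [H|/allPn[a ac nva]] := boolP (all (adj v) c); first by apply: Or32.
apply: Or33; have [i c' Ec] := rot_to ac.
have cntE : count (adj v) c = count (adj v) (a :: c').
  by rewrite -Ec; apply/seq.permP; rewrite perm_sym perm_rot.
have memE : c =i a :: c' by move=> z; rewrite -Ec mem_rot.
have cyc' : icycle (a :: c') by rewrite -Ec icycle_rot.
have sz' : 4 < size (a :: c') by rewrite -Ec size_rot.
rewrite memE in vc; rewrite cntE in cnt *.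
suff [H1 [z zc tw]] : count (adj v) (a :: c') = 3 /\
    exists2 z, z \in a :: c' & twin (a :: c') v z.
  by split=> //; exists z; rewrite ?memE // => y yc; apply: tw; rewrite -memE.
rewrite /= (negPf nva) add0n in cnt *.
have : has (adj v) c' by rewrite has_count ltnW.
case/has_split_first => D1 [y [E [Ec' avy hD1]]].
have : has (adj v) E.
  move: cnt; rewrite Ec' count_cat /= avy has_count.
  by move: hD1; rewrite has_count -leqNgt leqn0 => /eqP ->.
case/has_split_last => E1 [x [D2 [EE avx hD2]]].
pose d := x :: (D2 ++ a :: D1) ++ y :: E1.
have dE : perm_eq (a :: c') d.
  rewrite Ec' EE /d (_ : a :: _ = (a :: D1 ++ y :: E1) ++ x :: D2); last by cat_norm.
  by rewrite perm_catC; cat_norm.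
have [] := @hole_attach_gap x (D2 ++ a :: D1) y E1 v.
- move: cyc'; rewrite Ec' EE (_ : a :: _ = (a :: D1 ++ y :: E1) ++ x :: D2); last by cat_norm.
  by rewrite icycle_cat; cat_norm.
- by have := perm_size dE; rewrite /d /= !size_cat /= => e; move: sz'; rewrite /= e addnS !ltnS.
- by rewrite -/d -(perm_mem dE).
- by [].
- by [].
- by rewrite /nilp size_cat addnS.
- by rewrite has_cat /= negb_or hD2 negb_or nva hD1.
rewrite -/d -(seq.permP dE) /= (negPf nva) add0n => -> [z zd tw]; split=> //.
exists z; first by rewrite (perm_mem dE).
by move=> t tc; apply: tw; rewrite -(perm_mem dE).
Qed.


(** Numerical form of [hole_attach], for use on a hole rerouted through a twin. *)
Lemma hole_count c v : icycle c -> 4 < size c -> v \notin c ->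
  count (adj v) c \in [:: 0; 1; 3; size c].
Proof.
move=> cyc sz vc; rewrite !inE.
case: (hole_attach cyc sz vc) => [|/[!all_count] ->|[-> _]]; rewrite ?orbT //.
by case: (count _ _) => [|[|]].
Qed.

Lemma count_le1 (a : pred G) c y : uniq c -> count a c <= 1 -> y \in c -> a y ->
  {in c, forall t, a t = (t == y)}.
Proof.
move=> uc cnt yc ay t tc; case: eqVneq => [->//|ty]; apply/negP => at_.
have : uniq [:: t; y] by rewrite /= inE ty.
move/uniq_leq_size => /(_ (filter a c)); rewrite size_filter => H.
suff : 2 <= count a c by rewrite leqNgt ltnS cnt.
by apply: H => r; rewrite !inE mem_filter => /orP[] /eqP->; rewrite ?at_ ?ay.
Qed.

(** Exchanging [z] for [v] is injective on the hole and preserves adjacency there. *)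
Lemma icycle_twin c1 z c2 v : icycle (c1 ++ z :: c2) ->
  v \notin c1 ++ z :: c2 -> twin (c1 ++ z :: c2) v z -> icycle (c1 ++ v :: c2).
Proof.
set c := c1 ++ _ => cyc vc tw; pose f y := if y == z then v else y.
have uc := icycle_uniq cyc.
have fc y : y \in c -> y != z -> f y = y by move=> _ /negPf yz; rewrite /f yz.
have zfix s : z \notin s -> map f s = s.
  move=> zs; apply: map_id_in => y ys; rewrite /f.
  by case: eqVneq => // yz; rewrite -yz ys in zs.
have <- : map f c = c1 ++ v :: c2.
  move: uc; rewrite /c cat_uniq cons_uniq /= negb_or => /and4P[_ /andP[zc1 _] zc2 _].
  by rewrite map_cat /= !zfix // /f eqxx.
rewrite icycle_map //; rewrite /f.
- move=> a b ac bc; have [->|_] := eqVneq a z; have [->|_] := eqVneq b z => //.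
    by move=> vb; rewrite vb bc in vc.
  by move=> va; rewrite -va ac in vc.
- move=> a b ac bc; have [->|az] := eqVneq a z; have [->|bz] := eqVneq b z => //.
  + by rewrite !adj_irrefl.
  + by rewrite tw // (negPf bz).
  + by rewrite adj_sym tw // (negPf az) adj_sym.
Qed.

(** The attached path has at least two vertices, so together with the two arcs of the hole between
    [p] and [y] it forms a forbidden theta. *)
Lemma hole_ear c p y r R r' :
  icycle c -> 4 < size c -> p \in c -> y \in c -> p != y ->
  ipath (r :: rcons R r') -> {in r :: rcons R r', forall t, t \notin c} ->
  {in c, forall t, adj r t = (t == p)} -> {in c, forall t, adj r' t = (t == y)} ->
  {in R & c, forall a t, ~~ adj a t} -> False.
Proof.
move=> cyc sz pc yc py ip disj rp ry Rc.
have [i c' Ec] := rot_to pc.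
have memE t : (t \in p :: c') = (t \in c) by rewrite -Ec mem_rot.
have cyc' : icycle (p :: c') by rewrite -Ec icycle_rot.
have sz' : 4 < size (p :: c') by rewrite -Ec size_rot.
have : y \in c' by have := memE y; rewrite inE yc eq_sym (negPf py).
move=> yc'; case/splitPr: yc' Ec memE cyc' sz' => D E Ec memE cyc' sz'.
set Z := r :: rcons R r' in ip disj.
have nadjZ t a : t \in c -> a \in Z -> adj a t = ((a == r) && (t == p)) || ((a == r') && (t == y)).
  move=> tc; rewrite inE mem_rcons inE => /or3P[/eqP->|/eqP->|aR].
  - rewrite rp // eqxx /=; case: eqVneq => //= tp; have [rr'|//] := eqVneq r r'.
    by rewrite -ry // -rr' rp // (negPf tp).
  - rewrite ry // eqxx /=; case: eqVneq => //= ty; rewrite ?orbT //.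
    have [rr'|] := eqVneq r' r => //=.
    by rewrite -rp // -rr' ry // (negPf ty).
  - rewrite (negPf (Rc _ _ aR tc)); have u := ipath_uniq ip.
    have [ar|_] /= := eqVneq a r; first by move: u; rewrite /Z -ar /= mem_rcons inE aR orbT.
    have [ar'|_] //= := eqVneq a r'; by move: u; rewrite /Z -ar' /= rcons_uniq aR !andbF.
have neZ t a : t \in c -> a \in Z -> a != t.
  by move=> tc /disj; apply: contraNneq => ->.
have rr' : r != r' by move: (ipath_uniq ip); rewrite /= mem_rcons inE negb_or => /andP[/andP[]].
have rZ : r \in Z by rewrite mem_head.
have r'Z : r' \in Z by rewrite inE mem_rcons mem_head orbT.
have eZ : ear p y Z.
  rewrite /ear ipath_cons_head ip andbT /Z -rcons_cons ipath_rcons2 rcons_cons -/Z ip.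
  rewrite [adj p r]adj_sym rp // eqxx ry // eqxx !andTb.
  apply/andP; split; apply/allP => a aR.
    have aZ : a \in Z by rewrite inE aR orbT.
    rewrite nadj_sym /nadj neZ // nadjZ // eqxx andbT (negPf py) andbF orbF.
    by apply: contraTneq aR => ->; case/andP: (ipath_uniq ip).
  have aZ : a \in Z by rewrite inE mem_rcons inE orbCA -in_cons aR orbT.
  rewrite nadj_sym /nadj neZ // nadjZ // eqxx andbT [y == p]eq_sym (negPf py) andbF /=.
  apply: contraTneq aR => ->; have := ipath_uniq ip.
  by rewrite /Z -rcons_cons rcons_uniq => /andP[].
have anZ s : {subset s <= c} -> p \notin s -> y \notin s -> anti s Z.
  move=> sc ps ys; apply/antiP => t a ts aZ; have tc := sc _ ts.
  rewrite nadj_sym /nadj neZ // nadjZ //.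
  have [tp|_] := eqVneq t p; first by rewrite -tp ts in ps.
  have [ty|_] := eqVneq t y; first by rewrite -ty ts in ys.
  by rewrite !andbF.
move: (icycle_uniq cyc'); rewrite cons_uniq mem_cat inE !negb_or cat_uniq cons_uniq.
move=> /andP[/and3P[pD _ pE] /and3P[_ /= /norP[yD _] /andP[yE _]]].
move: cyc'; rewrite icycle_split theta2E.
move=> /andP[_ /and5P[_ /eqP axy eD eE DE]].
have th : theta p y [:: D; rev E; Z].
  rewrite theta3E py axy eD eE DE eZ /= orbF eqxx !anZ ?mem_rev //.
  - by move=> t; rewrite mem_rev => tE; rewrite -memE inE mem_cat inE tE !orbT.
  - by move=> t tD; rewrite -memE inE mem_cat tD orbT.
have Z2 : 1 < size Z by rewrite /Z /= size_rcons.
have [D0|D0] := posnP (size D); last first.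
  exact: (house_free_theta house_free (theta3_swap12 th)).
apply: (house_free_theta house_free th) => //.
by move: sz'; rewrite /= size_cat D0 size_rev /=; case: (size E).
Qed.

(** Let [w] be the first vertex of [Z] that sees the hole. If it sees one vertex only, [hole_ear]
    applies. Otherwise, as it misses [p], it is a twin of some [y], and [hole_ear] applies to the
    hole rerouted through [w]. *)
Lemma hole_ray c p z Z : icycle c -> 4 < size c -> p \in c ->
  {in c, forall t, adj z t = (t == p)} -> ipath (z :: Z) ->
  {in z :: Z, forall t, t \notin c} -> ~~ has (adj p) Z ->
  has (fun w => has (adj w) c) Z -> False.
Proof.
move=> cyc sz pc zp ip disj pZ.
case/has_split_first => Z1 [w [Z2 [EZ wc nZ1]]].
have {}ip : ipath (z :: rcons Z1 w).
  by move: ip; rewrite EZ -cat_rcons -cat_cons => /ipath_catl.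
have {}disj : {in z :: rcons Z1 w, forall t, t \notin c}.
  move=> t tZ; apply: disj; rewrite EZ -cat_rcons -cat_cons mem_cat.
  by rewrite tZ.
have npw : ~~ adj p w.
  by apply: contra pZ => pw; apply/hasP; exists w; rewrite // EZ mem_cat mem_head orbT.
have wc' : w \notin c by apply: disj; rewrite inE mem_rcons mem_head orbT.
have zc : z \notin c by apply: disj; rewrite mem_head.
have Z1c a t : a \in Z1 -> t \in c -> ~~ adj a t.
  by move=> aZ tc; apply: contra nZ1 => at_; apply/hasP; exists a => //; apply/hasP; exists t.
case: (hole_attach cyc sz wc') => [cnt|/allP/(_ _ pc)|[_ [y yc tw]]].
- have [y yc wy] := hasP wc; have wyE := count_le1 (icycle_uniq cyc) cnt yc wy.
  apply: (@hole_ear c p y z Z1 w) => //.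
  by apply: contraNneq npw => ->; rewrite adj_sym.
- by rewrite adj_sym (negPf npw).
have wy : adj w y by rewrite tw // eqxx.
have py : p != y by apply: contraNneq npw => ->; rewrite adj_sym.
case/splitPr: yc cyc sz pc zp disj wc wc' zc Z1c tw => c1 c2 cyc sz pc zp disj wc wc' zc Z1c tw.
have cyc' := icycle_twin cyc wc' tw; set c' := c1 ++ w :: c2 in cyc'.
have c'E t : t \in c' -> t = w \/ t \in c1 ++ y :: c2.
  rewrite !mem_cat !inE => /or3P[->|/eqP->|->]; rewrite ?orbT; by [left|right].
have sz' : 4 < size c' by move: sz; rewrite !size_cat.
have pc' : p \in c' by move: pc; rewrite !mem_cat !inE (negPf py) /= => /orP[] ->; rewrite ?orbT.
have wc1 : w \in c' by rewrite mem_cat mem_head orbT.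
have pw : p != w by apply: contraNneq wc' => <-.
have zw : z != w by move: (ipath_uniq ip); rewrite /= mem_rcons inE negb_or => /andP[/andP[]].
case/lastP: Z1 => [|R r'] in ip disj Z1c {nZ1 EZ} *.
  have azw : adj z w by move: ip; rewrite /= => /andP[/andP[]].
  have zc' : z \notin c'.
    by apply/negP => /c'E[] zE; [rewrite zE eqxx in zw|rewrite zE in zc].
  (* With nothing between [z] and [w], the vertex [z] would see exactly two vertices of the rerouted
     hole, [p] and [w]. *)
  have := hole_count cyc' sz' zc'.
  have : count (adj z) (c1 ++ y :: c2) = 1.
    rewrite (eq_in_count zp) -[RHS]/(nat_of_bool true) -pc.
    by rewrite -(count_uniq_mem _ (icycle_uniq cyc)).
  rewrite /c' !count_cat /= azw zp ?mem_cat ?mem_head ?orbT // [y == p]eq_sym (negPf py) add0n.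
  rewrite addnCA => ->; rewrite !inE /= => /eqP E.
  by move: sz'; rewrite /c' -E.
have zr' : {in z :: rcons R r', forall t, t \notin c'}.
  move=> t tR; apply/negP => /c'E[tw'|tc]; last first.
    by have := disj t; rewrite tc -rcons_cons mem_rcons inE tR orbT => /(_ isT).
  move: (ipath_uniq ip); rewrite -tw' -rcons_cons rcons_uniq.
  by rewrite tR.
move: ip; rewrite -rcons_cons -rcons_cons ipath_rcons2 => /and3P[ip r'w aw].
apply: (@hole_ear c' p w z R r') => //.
- move=> t /c'E[->|/zp//]; rewrite eq_sym (negPf pw).
  by have := allP aw z; rewrite mem_head adj_sym => /(_ isT) /andP[_ /negPf].
- move=> t /c'E[->|tc]; first by rewrite r'w eqxx.
  rewrite (negPf (Z1c _ _ _ tc)); last by rewrite mem_rcons mem_head.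
  by apply/esym; apply: contraNF wc' => /eqP <-.
- move=> a t aR /c'E[->|tc].
    by have := allP aw a; rewrite inE aR orbT adj_sym => /(_ isT) /andP[].
  by apply: Z1c => //; rewrite mem_rcons inE aR orbT.
Qed.

(** A path from one side of the hole to the other is reduced to [hole_ray]: directly if [z] sees a
    single vertex of the hole, and otherwise after rerouting the hole through [z], which is then a
    twin of a vertex of [P]. *)
Lemma hole_crossing c P Q s u z Z : icycle c -> 4 < size c ->
  {subset P <= c} -> {subset Q <= c} ->
  {in c, forall t, [|| t \in P, t \in Q, t == s | t == u]} ->
  has (adj s) Q -> has (adj u) Q ->
  ipath (z :: Z) -> {in z :: Z, forall t, t \notin c} ->
  has (adj z) P -> ~~ has (fun w => has (adj w) P) Z ->
  ~~ has (adj z) Q -> has (fun w => has (adj w) Q) Z -> False.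
Proof.
move=> cyc sz Pc Qc cE sQ uQ ip disj zP nZP nzQ ZQ.
have zc : z \notin c by apply: disj; rewrite mem_head.
have nZp w p : w \in Z -> p \in P -> ~~ adj w p.
  by move=> wZ pP; apply: contra nZP => wp; apply/hasP; exists w => //; apply/hasP; exists p.
have nzq q : q \in Q -> ~~ adj z q by move=> qQ; apply: (hasPn nzQ).
case: (hole_attach cyc sz zc) => [cnt|/allP all_z|[_ [y yc tw]]].
- have [p pP zp] := hasP zP; have pc := Pc _ pP.
  apply: (hole_ray cyc sz pc _ ip disj) => //.
  + exact: count_le1 (icycle_uniq cyc) cnt pc zp.
  + by apply/hasPn => w wZ; rewrite adj_sym nZp.
  + case/hasP: ZQ => w wZ /hasP[q qQ wq]; apply/hasP; exists w => //.
    by apply/hasP; exists q => //; apply: Qc.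
- by have [q qQ _] := hasP sQ; have := nzq _ qQ; rewrite all_z // Qc.
have zy : adj z y by rewrite tw // eqxx.
(* A twin of [s], of [u] or of a vertex of [Q] would see [Q]. *)
have yP : y \in P.
  have /or4P[//|yQ|/eqP ys|/eqP yu] := cE _ yc.
  - by have := nzq _ yQ; rewrite zy.
  - have [q qQ sq] := hasP sQ; have := nzq _ qQ.
    by rewrite tw ?Qc // ys sq orbT.
  - have [q qQ sq] := hasP uQ; have := nzq _ qQ.
    by rewrite tw ?Qc // yu sq orbT.
case/splitPr: yc cyc sz Pc Qc cE disj zc tw => c1 c2 cyc sz Pc Qc cE disj zc tw.
have cyc' := icycle_twin cyc zc tw; set c' := c1 ++ z :: c2 in cyc'.
have c'E t : t \in c' -> t = z \/ t \in c1 ++ y :: c2.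
  rewrite !mem_cat !inE => /or3P[->|/eqP->|->]; rewrite ?orbT; by [left|right].
have sz' : 4 < size c' by move: sz; rewrite !size_cat.
case: Z => [//|w Z] in ip disj nZP ZQ nZp *.
have zw : adj z w by move: ip => /= /andP[/andP[]].
have nwy : ~~ adj w y by apply: nZp; rewrite ?mem_head.
have wc : w \notin c1 ++ y :: c2 by apply: disj; rewrite !inE eqxx orbT.
have wc' : w \notin c'.
  by apply/negP => /c'E[wz|wc1]; [rewrite wz adj_irrefl in zw|rewrite wc1 in wc].
(* [w] sees one vertex more on the rerouted hole, and 0 and 1 are the only consecutive values
   allowed by [hole_count] when the length is at least 5. *)
have cnt : count (adj w) (c1 ++ y :: c2) = 0.
  have := hole_count cyc sz wc; have := hole_count cyc' sz' wc'.
  have -> : count (adj w) c' = (count (adj w) (c1 ++ y :: c2)).+1.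
    by rewrite /c' !count_cat /= adj_sym zw (negPf nwy) addnCA.
  have <- : size (c1 ++ y :: c2) = size c' by rewrite /c' !size_cat.
  rewrite !inE; case: (count _ _) => [|[|[|[|k]]]] //=; move: sz.
  + by case: (size _) => [|[|[|]]].
  + by case: (size _) => [|[|[|[|]]]].
  + by case: (size _) => [|[|[|[|[|]]]]].
  + by move=> _ /eqP <-; rewrite ltn_eqF.
have nwc t : t \in c1 ++ y :: c2 -> ~~ adj w t.
  by move: t; apply/hasPn; rewrite has_count cnt.
have zc' : z \in c' by rewrite mem_cat mem_head orbT.
apply: (@hole_ray c' z w Z) => //.
- move=> t /c'E[->|tc]; first by rewrite adj_sym zw eqxx.
  rewrite (negPf (nwc _ tc)); apply/esym.
  by apply: contraNF zc => /eqP <-.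
- by move: ip; rewrite ipath_cons_head => /and3P[].
- move=> t tZ; apply/negP => /c'E[tz|tc].
    by move: (ipath_head ip); rewrite -tz tZ.
  by have := disj t; rewrite inE tZ orbT tc => /(_ isT).
- move: ip; rewrite ipath_cons_head => /and3P[_ /allP H _].
  by apply/hasPn => t /H /andP[].
- case/hasP: ZQ => t tZ /hasP[q qQ tq].
  move: tZ; rewrite inE => /orP[/eqP tw'|tZ].
    by have := nwc _ (Qc _ qQ); rewrite -tw' tq.
  apply/hasP; exists t => //; apply/hasP; exists q => //.
  have qy : q != y by apply: contraTneq qQ => ->; apply: contraL zy; exact: nzq.
  by move: (Qc _ qQ); rewrite !mem_cat !inE (negPf qy) /= => /orP[] ->; rewrite ?orbT.
Qed.

End Hole.

(** * Two vertices of a full component dominate a minimal separator *)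

Section Domination.
Variable G : sgraph.
Implicit Types (x y z v w a b s u p q : G) (c P Q D E R : seq G) (S A B : {set G}).

(** The walk is shortened by jumping from [x] to the last vertex equal or adjacent to it, and by
    stopping as soon as [T] holds. *)
Lemma path_ipath (T : pred G) x (p : seq G) : path adj x p -> T (last x p) ->
  exists q : seq G, [/\ ipath (x :: q), {subset x :: q <= x :: p},
               T (last x q) & ~~ has T (belast x q)].
Proof.
have [n] := ubnP (size p); elim: n => // n IH in x p *; rewrite ltnS => szp xp Tp.
have [Tx|nTx] := boolP (T x).
  by exists [::]; split=> // z; rewrite !inE => ->.
case: p => [|y0 p0] in szp xp Tp *; first by rewrite (negPf nTx) in Tp.
have : has [pred t | (t == x) || adj x t] (y0 :: p0).
  by move: xp => /= /andP[-> _]; rewrite orbT.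
case/has_split_last => p1 [y [p2 [Ep /= xy np2]]].
move: xp Tp szp; rewrite Ep last_cat cat_path /= size_cat /= => /and3P[_ _ yp2] Tp szp.
have szp2 : size p2 < n.
  by apply: leq_trans szp; rewrite addnS ltnS leq_addl.
have [q [ipq qp2 Tq nTq]] := IH y p2 szp2 yp2 Tp.
have sub : {subset y :: p2 <= p1 ++ y :: p2} by move=> t t2; rewrite mem_cat t2 orbT.
case/orP: xy => [/eqP yx|xy].
  rewrite yx in ipq qp2 Tq nTq; exists q; split=> // t /qp2.
  rewrite inE => /orP[/eqP->|tp]; first exact: mem_head.
  by rewrite inE mem_cat inE tp !orbT.
exists (y :: q); split=> //; last by rewrite /= negb_or nTx.
- rewrite xy ipq andbT /=; apply/allP => t tq.
  have ty : t != y by apply: contraTneq tq => ->; apply: ipath_head ipq.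
  have := qp2 t; rewrite !inE tq orbT (negPf ty) => /(_ isT) /(hasPn np2) /=.
  by rewrite negb_or /nadj eq_sym.
- by move=> t; rewrite inE => /orP[/eqP->|/qp2/sub tp]; rewrite inE ?eqxx // tp orbT.
Qed.

(** The path is kept from the last neighbour of [s] on, so that [s] sees only its first vertex and
    [u] only its last. *)
Lemma ear_link s u a (q : seq G) : ipath (a :: q) -> s \notin a :: q -> u \notin a :: q ->
  adj s a -> adj u (last a q) -> ~~ has (adj u) (belast a q) ->
  exists b P, [/\ ear s u (b :: P), {subset b :: P <= a :: q}, adj s b,
                 last b P = last a q & u \notin b :: P].
Proof.
move=> ip sq uq sa uz nu.
have : has (adj s) (a :: q) by rewrite /= sa.
case/has_split_last => X [b [P [E sb nP]]].
have sub : {subset b :: P <= a :: q} by move=> t tP; rewrite E mem_cat tP orbT.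
have ubP : u \notin b :: P by apply: contra uq; apply: sub.
have lastE : last b P = last a q.
  by rewrite -[last a q]/(last a (a :: q)) E last_cat.
have ipb : ipath (b :: P) by move: ip; rewrite E => /ipath_catr.
exists b, P; split=> //; rewrite /ear ipath_cons_head sb ipb andbT.
have sP : all (nadj s) P.
  apply: all_nadj nP; apply: contra sq => sP; apply: sub.
  by rewrite inE sP orbT.
rewrite sP andTb (lastI b P) ipath_rcons2 -lastI ipb lastE adj_sym uz !andTb.
have EB : rcons (X ++ belast b P) (last b P) = rcons (belast a q) (last a q).
  by rewrite rcons_cat -!lastI.
have [EB' _] := rcons_inj EB.
apply: all_nadj.
  by apply: contra ubP; apply: mem_belast.
by apply: contra nu => h; rewrite -EB' has_cat h orbT.
Qed.

Definition connected_in A :=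
  {in A &, forall a b, exists p : seq G, [/\ path adj a p, last a p = b & {subset p <= A}]}.

(** A walk towards [p0] is cut before it enters [P] and then shortened to its first contact with
    [P]. [R] is empty when [w] itself sees [P]. *)
Lemma reach_segment A P p0 a w : connected_in A -> {subset P <= A} -> p0 \in P ->
  a \in A -> adj w a -> w \notin P ->
  exists R, [/\ ipath (w :: R), {subset R <= A}, {in R, forall t, t \notin P},
               has (adj (last w R)) P
             & ~~ has (fun t => has (adj t) P) (belast w R)].
Proof.
move=> conA PA p0P aA wa wP; have [p [pp lp pA]] := conA a p0 aA (PA _ p0P).
have : has (mem P) (a :: p).
  by apply/hasP; exists p0 => //; rewrite -lp; apply: mem_last.
case/has_split_first => X [y [Y [E /= yP nX]]].
have wp : path adj w (a :: p) by rewrite /= wa.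
move: wp; rewrite E cat_path /= => /and3P[wX ay _].
have T : has (adj (last w X)) P by apply/hasP; exists y.
have [R [ipR sub TR nTR]] := path_ipath (T := fun t => has (adj t) P) wX T.
have RX t : t \in R -> t \in X.
  move=> tR; have := sub t; rewrite !inE tR orbT => /(_ isT) /orP[/eqP tw|//].
  by move: (ipath_head ipR); rewrite -tw tR.
exists R; split=> // t /RX tX.
- have : t \in a :: p by rewrite E mem_cat tX.
  by rewrite inE => /orP[/eqP->|/pA].
- exact: (hasPn nX).
Qed.

Hypothesis house_free : induced_subdivision_free house G.

Lemma side_dominated S A B a0 : a0 \in A -> connected_in A -> connected_in B ->
  {in S, forall s, s \notin A /\ s \notin B} ->
  {in A & B, forall a b, nadj a b} ->
  {in S, forall s, (exists2 a, a \in A & adj s a) /\ (exists2 b, b \in B & adj s b)} ->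
  exists a1 a2, [/\ a1 \in A, a2 \in A & {in S, forall s, adj a1 s || adj a2 s}].
Proof.
move=> a0A conA conB SAB nAB full.
pose N a := [set s in S | adj a s].
case: (@arg_maxnP _ a0 (mem A) (fun a => #|N a|) a0A) => a aA maxa.
have [/forall_inP dom|/forall_inPn[u uS nau]] := boolP [forall s in S, adj a s].
  by exists a, a; split=> // s sS; rewrite dom.
have [[a' a'A ua'] [bu buB ubu]] := full u uS; have [uA uB] := SAB u uS.
have [p [pp lp pA]] := conA a a' aA a'A.
have Tp : adj u (last a p) by rewrite lp.
have [q [ipq subq uq nuq]] := path_ipath pp Tp.
have qA : {subset a :: q <= A}.
  by move=> t /subq; rewrite inE => /orP[/eqP->|/pA].
set z := last a q in uq.
have zA : z \in A by apply/qA/mem_last.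
(* By the maximal choice of [a]: otherwise [z] would see all of [N a] and also [u]. *)
have [s sN nzs] : exists2 s, s \in N a & ~~ adj z s.
  apply/exists_inP; apply: contraT; rewrite negb_exists_in => /forall_inP H.
  have : #|N a| < #|N z|.
    apply: proper_card; apply/properP; split.
      apply/subsetP => s sN; have := H s sN; rewrite negbK => zs.
      by move: sN; rewrite !inE => /andP[-> _].
    by exists u; rewrite !inE uS ?(negPf nau) // adj_sym uq.
  by move=> lt; have := maxa z zA; rewrite /= leqNgt lt.
move: sN; rewrite inE => /andP[sS a_s]; have [sA sB] := SAB s sS.
have [_ [b bB sb]] := full s sS.
have su : s != u by apply: contraNneq nau => <-.
have [p1 [P [eP subP sp1 ePl uP]]] : exists p1 P,
    [/\ ear s u (p1 :: P), {subset p1 :: P <= a :: q}, adj s p1,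
                 last p1 P = last a q & u \notin p1 :: P].
  by apply: ear_link => //; rewrite 1?adj_sym //; [apply: contra sA|apply: contra uA]; apply: qA.
have PA : {subset p1 :: P <= A} by move=> t /subP/qA.
have [pb [ppb lpb pbB]] := conB b bu bB buB.
have Tb : adj u (last b pb) by rewrite lpb.
have [qb [ipqb subqb uqb nuqb]] := path_ipath ppb Tb.
have qbB : {subset b :: qb <= B}.
  by move=> t /subqb; rewrite inE => /orP[/eqP->|/pbB].
have [q1 [Q [eQ subQ sq1 eQl uQ]]] : exists q1 Q,
    [/\ ear s u (q1 :: Q), {subset q1 :: Q <= b :: qb}, adj s q1,
                 last q1 Q = last b qb & u \notin q1 :: Q].
  by apply: ear_link => //; [apply: contra sB|apply: contra uB]; apply: qbB.
have QB : {subset q1 :: Q <= B} by move=> t /subQ/qbB.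
have aPQ : anti (p1 :: P) (q1 :: Q) by apply/antiP => t r /PA tA /QB rB; apply: nAB.
(* [s] misses [z], so its last neighbour on the path comes before [z]. *)
have Pn : P != [::].
  by apply: contraNneq nzs => P0; move: ePl; rewrite P0 /= /z => <-; rewrite adj_sym.
(* An edge [su] would be the empty ear of a theta whose ear [p1 :: P] has at least two vertices. *)
have nsu : ~~ adj s u.
  apply/negP => asu; have th : theta s u [:: [::]; q1 :: Q; p1 :: P].
    rewrite theta3E su asu eP eQ !anti_nill antiC aPQ /= /ear /=; done.
  by apply: (house_free_theta house_free th) => //=; case: (P) Pn.
set c := s :: (p1 :: P) ++ u :: rev (q1 :: Q).
have szc : 4 < size c.
  by rewrite /c /= size_cat /= size_rev; case: (P) Pn => // p2 P' _; rewrite /= addnS !addnS.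
have cyc : icycle c.
  rewrite /c icycle_split theta2E su (negPf nsu) revK eP eQ aPQ.
  by rewrite size_rev /= addnS.
have cE t : (t \in c) = [|| t \in p1 :: P, t \in q1 :: Q, t == s | t == u].
  rewrite /c !(inE, mem_cat, mem_rev).
  by case: (t == s); case: (t == u); rewrite ?orbT ?orbF //= -?orbA.
have zP : z \in p1 :: P by rewrite /z -ePl; apply: mem_last.
have zq : last q1 Q \in q1 :: Q by apply: mem_last.
have uq1 : adj u (last q1 Q) by rewrite eQl.
exists p1, z; split=> //; first by apply: PA; rewrite mem_head.
move=> w wS; apply: contraT; rewrite negb_or => /andP[np1w nzw].
have [wA wB] := SAB w wS.
have wc : w \notin c.
  apply/negP; rewrite cE => /or4P[/PA wA'|/QB wB'|/eqP ws|/eqP wu].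
  - by rewrite wA' in wA.
  - by rewrite wB' in wB.
  - by rewrite ws adj_sym sp1 in np1w.
  - by rewrite wu adj_sym uq in nzw.
have [[a1 a1A wa1] [b1 b1B wb1]] := full w wS.
have wP : w \notin p1 :: P by apply: contra wc; rewrite cE => ->.
have wQ : w \notin q1 :: Q by apply: contra wc; rewrite cE => ->; rewrite orbT.
have p1P : p1 \in p1 :: P by apply: mem_head.
have q1Q : q1 \in q1 :: Q by apply: mem_head.
have [R [ipR RA RP lR nR]] := reach_segment conA PA p1P a1A wa1 wP.
have [T [ipT TB TQ lT nT]] := reach_segment conB QB q1Q b1B wb1 wQ.
have nAQ t : t \in A -> ~~ has (adj t) (q1 :: Q).
  by move=> tA; apply/hasPn => r /QB rB; have /andP[] := nAB t r tA rB.
have nBP t : t \in B -> ~~ has (adj t) (p1 :: P).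
  by move=> tB; apply/hasPn => r /PA rA; have /andP[] := nAB r t rA tB; rewrite adj_sym.
(* If both are empty, [w] sees both sides of the hole. Then it is neither attached at one vertex
   nor, as it misses [p1], to all; a twin of a vertex on one side would miss the other side, and a
   twin of [s] or [u] would see [p1] or [z]. *)
have [RT0|RTn] := boolP (nilp R && nilp T).
  move: RT0 lR lT => /andP[/nilP -> /nilP ->] wP' wQ'.
  have [p0 p0P wp0] := hasP wP'; have [q0 q0Q wq0] := hasP wQ'.
  have p0q0 : nadj p0 q0 by apply: (antiP _ _ aPQ).
  have p0c : p0 \in c by rewrite cE p0P.
  have q0c : q0 \in c by rewrite cE q0Q orbT.
  case: (hole_attach house_free cyc szc wc) => [cnt|/allP/(_ p1)|[_ [y yc tw]]].
  - have := count_le1 (icycle_uniq cyc) cnt p0c wp0 q0c; rewrite wq0.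
    by move/esym/eqP => E; move: p0q0; rewrite E /nadj eqxx.
  - by rewrite cE p1P adj_sym (negPf np1w) => /(_ isT).
  have p1c : p1 \in c by rewrite cE p1P.
  have zc : z \in c by rewrite cE zP.
  move: yc; rewrite cE => /or4P[yP|yQ|/eqP ys|/eqP yu].
  - move: wq0; rewrite tw // => /orP[/eqP E|yq0].
      by have := antiP _ _ aPQ _ _ yP q0Q; rewrite E /nadj eqxx.
    by have := antiP _ _ aPQ _ _ yP q0Q; rewrite /nadj yq0 andbF.
  - move: wp0; rewrite tw // => /orP[/eqP E|yp0].
      by have := antiP _ _ aPQ _ _ p0P yQ; rewrite E /nadj eqxx.
    by have := antiP _ _ aPQ _ _ p0P yQ; rewrite /nadj adj_sym yp0 andbF.
  - by have := tw _ p1c; rewrite adj_sym (negPf np1w) ys sp1 orbT.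
  - by have := tw _ zc; rewrite adj_sym (negPf nzw) yu uq orbT.
exfalso.
(* The path starts at the end of [R], runs back to [w] and continues along [T], so only its first
   vertex sees [P]. *)
apply: (@hole_crossing G house_free c (p1 :: P) (q1 :: Q) s u
          (last w R) (rev (belast w R) ++ T) cyc szc) => //.
- by move=> t tP; rewrite cE tP.
- by move=> t tQ; rewrite cE tQ orbT.
- by move=> t; rewrite cE.
- by rewrite /= sq1.
- by apply/hasP; exists (last q1 Q).
- rewrite -cat_cons -rev_rcons -lastI rev_cons cat_rcons ipath_glue -rev_cons ipath_rev ipR ipT /=.
  by apply/antiP => t r; rewrite mem_rev => /RA tA /TB rB; apply: nAB.
- move=> t; rewrite -cat_cons -rev_rcons -lastI mem_cat mem_rev inE.
  move=> /orP[/orP[/eqP->//|tR]|tT]; apply/negP; rewrite cE.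
    have tA := RA _ tR; case/or4P=> [tP|/QB tB|/eqP ts|/eqP tu].
    + by have := RP _ tR; rewrite tP.
    + by have := nAB t t tA tB; rewrite /nadj eqxx.
    + by rewrite -ts tA in sA.
    + by rewrite -tu tA in uA.
  have tB := TB _ tT; case/or4P=> [/PA tA|tQ|/eqP ts|/eqP tu].
  + by have := nAB t t tA tB; rewrite /nadj eqxx.
  + by have := TQ _ tT; rewrite tQ.
  + by rewrite -ts tB in sB.
  + by rewrite -tu tB in uB.
- rewrite has_cat has_rev negb_or nR /=.
  by apply/hasPn => t /TB; apply: nBP.
(* If [R] is empty, the path starts at [w], and [T] is nonempty, so [w] does not see [Q]. *)
- case/lastP: R RTn ipR RA {RP nR lR} => [|R r] RTn _ RA; last first.
    by rewrite last_rcons; apply/nAQ/RA; rewrite mem_rcons mem_head.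
  by case: T RTn nT {ipT TB TQ lT} => // t T _ /=; rewrite negb_or => /andP[].
- apply/hasP; exists (last w T) => //.
  case/lastP: T RTn {ipT TB TQ lT nT} => [|T t] RTn.
    case: R RTn {ipR RA RP lR nR} => // r R _.
    by rewrite cats0 mem_rev /= mem_head.
  by rewrite last_rcons mem_cat mem_rcons mem_head orbT.
Qed.

End Domination.

(** * Counting minimal separators *)

Section Separators.
Variable G : sgraph.
Implicit Types (x y a b s : G) (S A B : {set G}).

Definition component S a : {set G} := [set x | same_component S a x].

Lemma same_component_sym S : connect_sym [rel x y : G | [&& x \notin S, y \notin S & adj x y]].
Proof.
by apply: sym_connect_sym => x y; rewrite /= adj_sym andbCA.
Qed.

Lemma component_refl S a : a \in component S a.
Proof. by rewrite inE; apply: connect0. Qed.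

Lemma component_notin S a x : a \notin S -> x \in component S a -> x \notin S.
Proof.
rewrite inE => aS /connectP[p]; case/lastP: p => [_ ->//|p y].
by rewrite rcons_path last_rcons => /andP[_ /= /and3P[_ yS _]] ->.
Qed.

Lemma component_closed S a x y : a \notin S ->
  x \in component S a -> adj x y -> y \notin S -> y \in component S a.
Proof.
move=> aS xA xy yS; have xS := component_notin aS xA; move: xA; rewrite !inE => ax.
by apply: connect_trans ax (connect1 _); rewrite /= xS yS.
Qed.

Lemma component_connected S a : a \notin S -> connected_in (component S a).
Proof.
move=> aS x y xA yA.
have : same_component S x y.
  apply: (@connect_trans _ _ a); last by rewrite inE in yA.
  by rewrite same_component_sym; rewrite inE in xA.
case/connectP=> p pp ->; exists p; split=> //.
  by apply: sub_path pp => t u /= /and3P[].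
move=> t; elim: p x xA pp => //= z p IH x xA /andP[/and3P[xS zS xz] pp].
have zA := component_closed aS xA xz zS.
by rewrite inE => /orP[/eqP->//|]; apply: IH pp.
Qed.

(** If no vertex of the component saw [s], giving [s] back to the graph would leave the component
    closed, and [b] outside it. *)
Lemma component_full S a b s : a \notin S -> ~~ same_component S a b ->
  same_component (S :\ s) a b -> exists2 x, x \in component S a & adj s x.
Proof.
move=> aS nab ab; apply/exists_inP; apply: contraT; rewrite negb_exists_in => /forall_inP H.
have cl : closed [rel x y : G | [&& x \notin S :\ s, y \notin S :\ s & adj x y]] (component S a).
  apply: intro_closed; first exact: same_component_sym.
  move=> x y /= /and3P[_ + xy] xA; rewrite !inE negb_and negbK => /orP[/eqP ys|].
    by have := H x xA; rewrite -ys adj_sym xy.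
  by have := component_closed aS xA xy; rewrite inE.
have := closed_connect cl ab; rewrite component_refl => /esym.
by rewrite inE (negPf nab).
Qed.

(** [A] and [B] are full components: minimality gives every vertex of [S] a neighbour in each. The
    closure conditions say that edges leave them only towards [S]. *)
Lemma minimal_separator_sides S : minimal_separator S -> exists a b A B,
  [/\ a \in A, b \in B, connected_in A /\ connected_in B,
      {in A & B, forall x y, nadj x y} &
  [/\ {in S, forall s, s \notin A /\ s \notin B},
      {in S, forall s, (exists2 x, x \in A & adj s x) /\ (exists2 x, x \in B & adj s x)},
      {in A, forall x y, adj x y -> y \notin S -> y \in A} &
      {in B, forall x y, adj x y -> y \notin S -> y \in B}]].
Proof.
case/existsP=> a /existsP[b /and5P[aS bS _ nab /forallP minS]].
have symE S' : same_component S' b a = same_component S' a b.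
  by rewrite /same_component same_component_sym.
exists a, b, (component S a), (component S b); split; rewrite ?component_refl //.
- by split; apply: component_connected.
- move=> x y xA yB; rewrite /nadj -negb_or; apply: contra nab => xy.
  have xB : x \in component S b.
    case/orP: xy => [/eqP -> //|xy].
    by apply: component_closed yB _ (component_notin aS xA); rewrite // adj_sym.
  rewrite !inE in xA xB; apply: connect_trans xA _.
  by rewrite same_component_sym.
split.
- by move=> s sS; split; apply: contraL sS; apply: component_notin.
- move=> s sS; have := minS (S :\ s); rewrite properD1 // => /= ab.
  split; first exact: component_full ab.
  by apply: (@component_full S b a); rewrite ?symE.
- by move=> x xA y; apply: component_closed.
- by move=> x xA y; apply: component_closed.
Qed.

(** A vertex outside [S] seen by both dominating pairs would lie in both components. *)
Lemma house_free_separator S : induced_subdivision_free house G ->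
  minimal_separator S ->
  exists t : G * G * (G * G),
    S = [set x | (adj t.1.1 x || adj t.1.2 x) && (adj t.2.1 x || adj t.2.2 x)].
Proof.
move=> free /minimal_separator_sides[a [b [A [B [aA bB [conA conB] nAB [SAB full clA clB]]]]]].
have [a1 [a2 [a1A a2A domA]]] := side_dominated free aA conA conB SAB nAB full.
have [b1 [b2 [b1B b2B domB]]] : exists a1 a2,
    [/\ a1 \in B, a2 \in B & {in S, forall s, adj a1 s || adj a2 s}].
  apply: (side_dominated free bB conB conA).
  - by move=> s /SAB[].
  - by move=> x y xB yA; rewrite nadj_sym nAB.
  - by move=> s /full[].
exists ((a1, a2), (b1, b2)); apply/setP => x; rewrite inE /=.
apply/idP/andP => [xS|[xa xb]]; first by rewrite domA ?domB.
apply: contraT => xS.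
have xA : x \in A by case/orP: xa => xa; [apply: (clA a1)|apply: (clA a2)].
have xB : x \in B by case/orP: xb => xb; [apply: (clB b1)|apply: (clB b2)].
by have := nAB _ _ xA xB; rewrite /nadj eqxx.
Qed.

(** One of the two components has no edge; being connected, it is a single vertex, and fullness
    makes [S] its neighbourhood. *)
Lemma two_P2_free_separator S : induced_subdivision_free two_P2 G ->
  minimal_separator S -> exists a, S = [set x | adj a x].
Proof.
move=> free /minimal_separator_sides[a [b [A [B [aA bB [conA conB] nAB [SAB full clA clB]]]]]].
have edgeless (A' : {set G}) a' : a' \in A' -> connected_in A' ->
    {in S, forall s, exists2 x, x \in A' & adj s x} ->
    {in A', forall x y, adj x y -> y \notin S -> y \in A'} ->
    ~~ [exists x in A', exists y in A', adj x y] -> S = [set x | adj a' x].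
  move=> a'A con fl cl /exists_inPn noE.
  have nE x y : x \in A' -> y \in A' -> ~~ adj x y.
    by move=> xA yA; have /exists_inPn/(_ _ yA) := noE x xA.
  apply/setP => x; rewrite inE; apply/idP/idP => [xS|a'x].
    have [y yA xy] := fl x xS; have [p [pp lp pA]] := con _ _ a'A yA.
    case: p pp lp pA => [_ /= ->|z p /= /andP[a'z _] _ pA]; first by rewrite adj_sym.
    by have := nE _ _ a'A (pA z (mem_head _ _)); rewrite a'z.
  apply: contraT => xS; have xA := cl _ a'A _ a'x xS.
  by have := nE _ _ a'A xA; rewrite a'x.
have [/exists_inP[x xA /exists_inP[y yA xy]]|noA] :=
    boolP [exists x in A, exists y in A, adj x y]; last first.
  by exists a; apply: (edgeless A) => // s /full[].
have [/exists_inP[z zB /exists_inP[w wB zw]]|noB] :=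
    boolP [exists x in B, exists y in B, adj x y]; last first.
  by exists b; apply: (edgeless B) => // s /full[].
case: free; apply: embeds_itm; pose s := [:: x; y; z; w].
have /andP[xz /negPf nxz] := nAB _ _ xA zB; have /andP[xw /negPf nxw] := nAB _ _ xA wB.
have /andP[yz /negPf nyz] := nAB _ _ yA zB; have /andP[yw /negPf nyw] := nAB _ _ yA wB.
have us : uniq s by rewrite /= !inE !negb_or (adj_neq xy) (adj_neq zw) xz xw yz yw.
exists (fun i : two_P2 => nth x s (nat_of_ord (i : 'I_4))).
  by move=> i j /eqP; rewrite nth_uniq ?ltn_ord // => /eqP/val_inj.
case=> [[|[|[|[|//]]]] ?] [[|[|[|[|//]]]] ?];
  rewrite /= ?adj_irrefl ?xy ?zw ?nxz ?nxw ?nyz ?nyw //;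
  by rewrite adj_sym ?xy ?zw ?nxz ?nxw ?nyz ?nyw.
Qed.

End Separators.

(** * Polynomial bounds on the number of minimal separators *)

Section Tame.
Local Open Scope ring_scope.
Import GRing.Theory Num.Theory.
Variable R : realType.

Lemma tame_two_P2 (H : sgraph) : induced_topological_minor H two_P2 ->
  tame R (induced_subdivision_free H).
Proof.
move=> HK; exists 'X => G free; rewrite hornerX ler_nat.
have {}free : induced_subdivision_free two_P2 G by move=> KG; apply/free/(itm_trans HK).
apply: leq_trans (leq_imset_card (fun a : G => [set x | adj a x]) (mem G)).
apply/subset_leq_card/subsetP => S; rewrite inE => /(two_P2_free_separator free)[a ->].
exact: imset_f.
Qed.

Lemma tame_house (H : sgraph) : induced_topological_minor H house ->
  tame R (induced_subdivision_free H).
Proof.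
move=> HK; exists ('X^4) => G free; rewrite hornerXn -natrX ler_nat.
have {}free : induced_subdivision_free house G by move=> KG; apply/free/(itm_trans HK).
have -> : (#|G| ^ 4 = #|{: G * G * (G * G)}|)%N by rewrite !card_prod !expnS expn0 muln1 mulnA.
pose F (t : G * G * (G * G)) :=
  [set x | (adj t.1.1 x || adj t.1.2 x) && (adj t.2.1 x || adj t.2.2 x)].
apply: leq_trans (leq_imset_card F _).
apply/subset_leq_card/subsetP => S; rewrite inE => /(house_free_separator free)[t ->].
exact: imset_f.
Qed.

End Tame.

(** * Tame classes are not feral *)

Section BoundedOrder.
Variable N : nat.

(** The order and the adjacency matrix along the enumeration of the vertices, placed in a fixed
    finite type. *)
Definition graph_code (G : sgraph) : 'I_N.+1 * {set 'I_N * 'I_N} :=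
  (inord #|G|, [set p : 'I_N * 'I_N |
    [exists x : G, exists y : G,
      [&& enum_rank x == p.1 :> nat, enum_rank y == p.2 :> nat & adj x y]]]).

Lemma graph_code_inj (G G' : sgraph) : #|G| <= N -> #|G'| <= N ->
  graph_code G = graph_code G' -> isomorphic G G'.
Proof.
move=> szG szG' [/(congr1 val) + codeE]; rewrite /= !inordK ?ltnS // => cardE.
pose f (x : G) : G' := enum_val (cast_ord cardE (enum_rank x)).
exists f.
  exists (fun y => enum_val (cast_ord (esym cardE) (enum_rank y))) => x.
    by rewrite /f enum_valK cast_ordK enum_rankK.
  by rewrite /f enum_valK cast_ordKV enum_rankK.
have rankP (K : sgraph) (szK : #|K| <= N) (x y : K) :
    adj x y = ((widen_ord szK (enum_rank x), widen_ord szK (enum_rank y))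
               \in (graph_code K).2).
  rewrite inE /=; apply/idP/existsP => [xy|[x' /existsP[y' /and3P[/eqP/val_inj/enum_rank_inj -> /eqP/val_inj/enum_rank_inj -> //]]]].
  by exists x; apply/existsP; exists y; rewrite !eqxx.
have {}codeE : (graph_code G).2 = (graph_code G').2 := codeE.
move=> x y; rewrite (rankP _ szG) (rankP _ szG') codeE.
have fE z : widen_ord szG' (enum_rank (f z)) = widen_ord szG (enum_rank z).
  by apply: val_inj; rewrite /= /f enum_valK.
by rewrite !fE.
Qed.

(** Pigeonhole: otherwise [M.+1] pairwise nonisomorphic graphs would have distinct codes among
    [M]. *)
Lemma unbounded_order (F : nat -> sgraph) :
  (forall i j, i != j -> ~ isomorphic (F i) (F j)) -> exists i, N < #|F i|.
Proof.
move=> Fneq; pose M := #|{: 'I_N.+1 * {set 'I_N * 'I_N}}|.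
have [/existsP[i]|] := boolP [exists i : 'I_M.+1, N < #|F i|]; first by exists i.
rewrite negb_exists => /forallP small.
have inj : injective (fun i : 'I_M.+1 => graph_code (F i)).
  move=> i j /graph_code_inj iso; apply/eqP; apply: contraT => ij.
  by case: (Fneq i j ij); apply: iso; rewrite leqNgt.
by have := leq_card _ inj; rewrite card_ord ltnn.
Qed.

End BoundedOrder.

Section Growth.
Local Open Scope ring_scope.
Import Order.TTheory GRing.Theory Num.Theory.
Variable R : realType.

Lemma sqrt_gt1 (c : R) : 1 < c -> 1 < Num.sqrt c.
Proof. by move=> c1; rewrite -[ltLHS]sqrtr1 ltr_sqrt // (lt_trans ltr01). Qed.

Lemma bernoulli (h : R) (n : nat) : 0 <= h -> 1 + h *+ n <= (1 + h) ^+ n.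
Proof.
move=> h0; elim: n => [|n IH]; first by rewrite mulr0n addr0.
rewrite exprS mulrDl mul1r mulrS addrCA addrC; apply: lerD => //.
by rewrite ler_peMr // exprn_ege1 // lerDl.
Qed.

(** Induction on [d] with [c] written as the square of [e]: one factor [e ^+ n] absorbs [n] by
    Bernoulli's inequality, the other absorbs [n%:R ^+ d]. *)
Lemma exp_dominates_power (d : nat) (c : R) : 1 < c ->
  exists2 K : R, 0 <= K & forall n : nat, n%:R ^+ d <= K * c ^+ n.
Proof.
elim: d c => [|d IH] c c1.
  by exists 1 => // n; rewrite mul1r expr0 exprn_ege1 // ltW.
have c1' := sqrt_gt1 c1; have [K K0 HK] := IH _ c1'.
have h0 : 0 < Num.sqrt c - 1 by rewrite subr_gt0.
exists (K / (Num.sqrt c - 1)); first by rewrite divr_ge0 // ltW.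
move=> n; set e := Num.sqrt c in c1' HK h0 *.
have -> : c = e ^+ 2 by rewrite sqr_sqrtr // ltW // (lt_trans ltr01).
have Hn : n%:R <= e ^+ n / (e - 1).
  rewrite ler_pdivlMr // mulr_natl.
  have := bernoulli n (ltW h0); rewrite subrKC => /(le_trans _); apply.
  by rewrite lerDr.
rewrite exprS; apply: le_trans (ler_pM _ _ Hn (HK n)) _; rewrite ?exprn_ge0 //.
by rewrite -exprM mulnC exprM expr2 le_eqVlt; apply/orP; left; apply/eqP; ring.
Qed.

Lemma horner_le_power (p : {poly R}) (x : R) : 1 <= x ->
  p.[x] <= (\sum_(i < size p) `|p`_i|) * x ^+ size p.
Proof.
move=> x1; rewrite horner_coef mulr_suml; apply: ler_sum => i _.
apply: le_trans (ler_norm _) _; rewrite normrM ler_wpM2l // ger0_norm.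
  by rewrite ler_weXn2l // ltnW.
by rewrite exprn_ge0 // (le_trans ler01).
Qed.

Lemma tame_not_feral (C : sgraph -> Prop) : tame R C -> ~ feral R C.
Proof.
move=> [p Hp] [c c1 [F [Fneq HF]]].
pose B := \sum_(i < size p) `|p`_i|; have B0 : 0 <= B by apply: sumr_ge0.
(* One more than the exponent that bounds [p], so that the comparison leaves [n <= K * B], which
   fails for large orders. *)
have [K K0 HK] := exp_dominates_power (size p).+1 c1.
have [i Ni] := unbounded_order (Num.bound (K * B)) Fneq.
have [CF cF] := HF i; set n := #|F i| in Ni cF.
have n1 : 1 <= n%:R :> R by rewrite (ler_nat _ 1); apply: leq_ltn_trans Ni.
have n0 : 0 < n%:R :> R := lt_le_trans ltr01 n1.
have h : c ^+ n <= B * n%:R ^+ size p.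
  exact: le_trans (le_trans cF (Hp _ CF)) (horner_le_power p n1).
have : n%:R <= K * B.
  rewrite -(ler_pM2r (exprn_gt0 (size p) n0)) -exprS -mulrA.
  exact: le_trans (HK n) (ler_wpM2l K0 h).
apply/negP; rewrite -ltNge; apply: lt_trans (archi_boundP (mulr_ge0 K0 B0)) _.
by rewrite ltr_nat.
Qed.



End Growth.

(** * Ladders *)

Section Ladder.
Variables (cl : bool) (k : nat).

(* Two sides, each with a hub [(e, None)], joined by a matching of size [k];
   each side is a clique if [cl] holds, and a star centred at its hub otherwise. *)
Definition ladder_adj : rel (bool * option 'I_k) := fun u v =>
  if u.1 == v.1 then (u.2 != v.2) && [|| cl, u.2 == None | v.2 == None]
  else (u.2 == v.2) && (u.2 != None).

Lemma ladder_sym : symmetric ladder_adj.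
Proof.
move=> u v; rewrite /ladder_adj eq_sym; case: eqP => _.
  by rewrite eq_sym [(u.2 == _) || _]orbC.
by rewrite eq_sym; case: eqP => // ->.
Qed.

Lemma ladder_irrefl : irreflexive ladder_adj.
Proof. by move=> u; rewrite /ladder_adj !eqxx. Qed.

Definition ladder : sgraph := SGraph ladder_sym ladder_irrefl.

Lemma card_ladder : #|ladder| = (k.+1).*2.
Proof. by rewrite card_prod card_bool card_option card_ord mul2n. Qed.

Definition transversal_set (f : {ffun 'I_k -> bool}) : {set ladder} :=
  [set u | if u.2 is Some i then u.1 == f i else false].

Lemma transversal_set_inj : injective transversal_set.
Proof.
move=> f g /setP E; apply/ffunP => i.
by have := E (true, Some i); rewrite !inE /=; case: (f i); case: (g i).
Qed.

Lemma transversal_set_separator f : minimal_separator (transversal_set f).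
Proof.
apply/existsP; exists (false, None); apply/existsP; exists (true, None).
rewrite !inE /=; apply/andP; split.
  pose e := [rel x y : ladder |
    [&& x \notin transversal_set f, y \notin transversal_set f & adj x y]].
  (* Edges between the two sides are rungs, and the set contains an end of every rung. *)
  have cl1 : closed e [pred u | u.1].
    move=> [b1 o1] [b2 o2] /=; rewrite !inE /= /ladder_adj /= => /and3P[].
    case: eqVneq => [//|/= b12]; case: o1 => [i|]; last by rewrite andbF.
    move=> h1 h2 /andP[/eqP E _]; move: h1 h2 b12; rewrite -E.
    by case: b1; case: b2; case: (f i).
  apply/negP => /(closed_connect cl1); rewrite !inE //.
apply/forallP => S'; apply/implyP => /properP[/subsetP sub [u]].
rewrite inE; case: u => e [i|//] /= /eqP ->{e} uS'.
have hub b : (b, None) \notin S' by apply/negP => /sub; rewrite inE.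
have rung b : (b, Some i) \notin S'.
  have [->//|bf] := eqVneq b (f i).
  by apply/negP => /sub; rewrite inE /= (negPf bf).
(* A proper subset leaves both ends of some rung [i], and the path of length 3 through it joins the
   hubs. *)
apply: (@connect_trans _ _ (false, Some i)).
  by apply: connect1; rewrite /= hub rung /ladder_adj /= orbT.
apply: (@connect_trans _ _ (true, Some i)).
  by apply: connect1; rewrite /= !rung /ladder_adj /= eqxx.
by apply: connect1; rewrite /= hub rung /ladder_adj /= orbT.
Qed.

Lemma ladder_separators : 2 ^ k <= #|minimal_separators ladder|.
Proof.
rewrite -{1}card_bool -[k in _ ^ k]card_ord -card_ffun.
rewrite -(card_imset _ transversal_set_inj); apply/subset_leq_card/subsetP => S.
by case/imsetP=> f _ ->; rewrite inE; apply: transversal_set_separator.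
Qed.

End Ladder.

Section FeralLadders.
Local Open Scope ring_scope.
Import Order.TTheory GRing.Theory Num.Theory.
Variable R : realType.

Lemma feral_ladders (cl : bool) (C : sgraph -> Prop) :
  (forall k, C (ladder cl k)) -> feral R C.
Proof.
(* The fourth root of 2 works because a ladder with [k.+1] rungs has $2k+4 \le 4(k+1)$ vertices and
   at least $2^{k+1}$ minimal separators. *)
move=> CL; have c1 : 1 < Num.sqrt (Num.sqrt 2) :> R by rewrite !sqrt_gt1 // ltr1n.
exists (Num.sqrt (Num.sqrt 2)) => //; exists (fun k => ladder cl k.+1); split.
  move=> i j ij [f fbij _]; move: (bij_eq_card fbij); rewrite !card_ladder.
  by move/double_inj => -[] /eqP; rewrite (negPf ij).
move=> k; split => //; apply: (@le_trans _ _ (2 ^ k.+1)%:R); last first.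
  by rewrite ler_nat ladder_separators.
have -> : (2 ^ k.+1)%:R = Num.sqrt (Num.sqrt 2) ^+ (4 * k.+1) :> R.
  by rewrite exprM (exprM _ 2 2) !sqr_sqrtr ?sqrtr_ge0 // natrX.
rewrite card_ladder; apply: ler_weXn2l; first exact: ltW.
by rewrite -[4%N]/(2 * 2)%N -mulnA -mul2n leq_pmul2l // mul2n -addnn addSn ltnS leq_addl.
Qed.
End FeralLadders.

(** * Obstructions inherited by subdivisions *)

Definition has_independent3 (K : sgraph) : Prop :=
  exists a b c : K, [/\ nadj a b, nadj a c & nadj b c].

Definition large_triangle_free (K : sgraph) : Prop :=
  4 < #|K| /\ forall a b c : K, ~~ [&& adj a b, adj b c & adj a c].

Definition three_branch (K : sgraph) : Prop :=
  exists a b c : K, [/\ uniq [:: a; b; c], 2 < #|[set x | adj a x]|,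
    2 < #|[set x | adj b x]| & 2 < #|[set x | adj c x]|].

(** Stand-in for a cycle: such a set contains the vertices of one, and the condition passes directly
    to subdivisions and to images under embeddings. *)
Definition mindeg2 (K : sgraph) (T : {set K}) : Prop :=
  T != set0 /\ {in T, forall x, 1 < #|[set y in T | adj x y]|}.

Definition undominated_cycle (K : sgraph) : Prop :=
  exists (T : {set K}) v, [/\ mindeg2 T, v \notin T & {in T, forall x, ~~ adj v x}].

Definition edge_disjoint_cycles (K : sgraph) : Prop :=
  exists T T' : {set K}, [/\ mindeg2 T, mindeg2 T' & #|T :&: T'| <= 1].

Section SubdivisionInvariance.
Variables (K : sgraph) (u v : K).
Hypothesis uv : adj u v.
Notation K' := (subdivide_edge u v).

Lemma subdivide_nadj (a b : K) : nadj a b -> @nadj K' (Some a) (Some b).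
Proof. by rewrite /nadj /= (inj_eq Some_inj) => /andP[-> /negPf ->]. Qed.

Lemma subdivide_independent3 : has_independent3 K -> has_independent3 K'.
Proof.
by move=> [a [b [c [ab ac bc]]]]; exists (Some a), (Some b), (Some c); split; apply: subdivide_nadj.
Qed.

(** A triangle through the new vertex would contain [u] and [v], which are no longer adjacent. *)
Lemma subdivide_large_triangle_free : large_triangle_free K -> large_triangle_free K'.
Proof.
move=> [sz tf]; split; first by rewrite card_option ltnW.
have nb (a b : K) : a \in [set u; v] -> b \in [set u; v] -> @adj K' (Some a) (Some b) = false.
  rewrite !inE /= => /orP[]/eqP-> /orP[]/eqP->; rewrite ?adj_irrefl ?eqxx ?andbF //.
  by rewrite setUC eqxx andbF.
have tri (a b : K) : ~~ [&& @adj K' (Some a) (Some b), @adj K' (Some b) None & @adj K' (Some a) None].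
  apply/negP => /and3P[ab bn an]; by rewrite nb in ab.
move=> [a|] [b|] [c|] //; try by rewrite /= ?andbF.
- by apply: contra (tf a b c) => /= /and3P[/andP[-> _] /andP[-> _] /andP[-> _]].
- apply: contra (tri a c) => /and3P[an nc ac]; rewrite ac an andbT /=.
  by [].
- apply: contra (tri b c) => /and3P[nb' bc nc]; rewrite bc; apply/andP; split=> //.
  by rewrite /= in nb' nc *; rewrite nb' nc.
Qed.

(* A neighbour of an old vertex is replaced by the new vertex or kept. *)
Lemma subdivide_degree (a : K) (T : {set K}) (T' : {set K'}) :
  (forall x, x \in T -> Some x \in T') ->
  (a \in [set u; v] -> u \in T -> v \in T -> None \in T') ->
  a \in T ->
  #|[set x in T | adj a x]| <= #|[set x in T' | @adj K' (Some a) x]|.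
Proof.
move=> TT' nT' aT.
pose g (x : K) : K' := if [set a; x] == [set u; v] then None else Some x.
rewrite -(@card_in_imset _ _ g).
  apply/subset_leq_card/subsetP => y /imsetP[x]; rewrite inE => /andP[xT ax] ->.
  rewrite inE /g; case: eqVneq => [E|ne] /=; last by rewrite TT' // ax ne.
  have aE : a \in [set u; v] by rewrite -E set21.
  have [uE vE] : (u \in [set a; x]) /\ (v \in [set a; x]) by rewrite E set21 set22.
  have inT t : t \in [set a; x] -> t \in T by rewrite !inE => /orP[]/eqP->.
  by rewrite aE nT' // inT.
move=> x y; rewrite !inE /g => /andP[_ ax] /andP[_ ay].
case: eqVneq => [Ex|_]; case: eqVneq => [Ey|_] //; last by case.
move=> _.
have : x \in [set a; y] by rewrite Ey -Ex set22.
by rewrite !inE => /orP[/eqP xa|/eqP//]; rewrite xa adj_irrefl in ax.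
Qed.

Lemma subdivide_three_branch : three_branch K -> three_branch K'.
Proof.
have deg (a : K) : #|[set x | adj a x]| <= #|[set x | @adj K' (Some a) x]|.
  have -> : [set x | adj a x] = [set x in [set: K] | adj a x] by apply/setP => x; rewrite !inE.
  have -> : [set x | @adj K' (Some a) x] = [set x in [set: K'] | @adj K' (Some a) x].
    by apply/setP => x; rewrite !inE.
  by apply: subdivide_degree => *; rewrite inE.
move=> [a [b [c [uabc da db dc]]]]; exists (Some a), (Some b), (Some c); split.
- by rewrite -(map_inj_uniq Some_inj) in uabc.
- exact: leq_trans (deg a).
- exact: leq_trans (deg b).
- exact: leq_trans (deg c).
Qed.

Definition subdivide_set (T : {set K}) : {set K'} :=
  [set x | if x is Some y then y \in T else (u \in T) && (v \in T)].

Lemma subdivide_mindeg2 (T : {set K}) : mindeg2 T -> mindeg2 (subdivide_set T).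
Proof.
move=> [/set0Pn[x0 x0T] deg]; split.
  by apply/set0Pn; exists (Some x0); rewrite inE.
move=> [x|]; rewrite inE.
  move=> xT; apply: leq_trans (deg _ xT) _.
  by apply: subdivide_degree xT => [y yT|_ uT vT]; rewrite inE // uT.
move=> /andP[uT vT].
have -> : [set y in subdivide_set T | @adj K' None y] = [set Some u; Some v].
  apply/setP => -[y|]; rewrite !inE /=; last by rewrite andbF.
  rewrite !inE !(inj_eq Some_inj); case: eqVneq => [->|_]; first by rewrite uT.
  by case: eqVneq => [->|]; rewrite ?vT ?andbF.
by rewrite cards2 (inj_eq Some_inj) (adj_neq uv).
Qed.

Lemma subdivide_undominated : undominated_cycle K -> undominated_cycle K'.
Proof.
move=> [T [w [degT wT nw]]]; exists (subdivide_set T), (Some w); split.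
- exact: subdivide_mindeg2.
- by rewrite inE.
- move=> [y|]; rewrite inE /=; first by move=> /nw /negPf ->.
  by case/andP=> uT vT; rewrite !inE; apply: contra wT => /orP[]/eqP->.
Qed.

(** The intersection cannot contain both [u] and [v], so it does not gain the new vertex. *)
Lemma subdivide_edge_disjoint : edge_disjoint_cycles K -> edge_disjoint_cycles K'.
Proof.
move=> [T [T' [dT dT' sz]]]; exists (subdivide_set T), (subdivide_set T'); split.
- exact: subdivide_mindeg2.
- exact: subdivide_mindeg2.
have nuv : ~~ ((u \in T :&: T') && (v \in T :&: T')).
  apply/negP => /andP[uT vT]; have : #|[set u; v]| <= 1.
    apply: leq_trans sz; apply/subset_leq_card/subsetP => x.
    by rewrite !inE => /orP[]/eqP->; rewrite -in_setI.
  by rewrite cards2 (adj_neq uv).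
apply: leq_trans sz; have <- : #|Some @: (T :&: T')| = #|T :&: T'|.
  by apply: card_imset; apply: Some_inj.
apply/subset_leq_card/subsetP => -[y|].
  by rewrite !inE => yT; apply/imset_f; rewrite inE.
by rewrite !inE => /andP[/andP[uT vT] /andP[uT' vT']]; move: nuv; rewrite !inE uT vT uT' vT'.
Qed.

End SubdivisionInvariance.

Lemma subdivision_preserves (P : sgraph -> Prop) (H H' : sgraph) :
  (forall (K : sgraph) (u v : K), adj u v -> P K -> P (subdivide_edge u v)) ->
  subdivision H H' -> P H -> P H'.
Proof.
move=> step sub PH; elim: H' / sub => // K u v _ PK uv; exact: step.
Qed.

(** * Obstructions that the ladders avoid *)

Lemma embeds_degree (H K : sgraph) (f : H -> K) (T : {set H}) (x : H) :
  injective f -> (forall a b, adj (f a) (f b) = adj a b) ->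
  #|[set y in T | adj x y]| <= #|[set y in f @: T | adj (f x) y]|.
Proof.
move=> finj fadj; rewrite -(card_imset _ finj); apply/subset_leq_card/subsetP => y.
by case/imsetP=> z; rewrite inE => /andP[zT xz] ->; rewrite inE imset_f // fadj.
Qed.

Lemma embeds_mindeg2 (H K : sgraph) (f : H -> K) (T : {set H}) :
  injective f -> (forall a b, adj (f a) (f b) = adj a b) ->
  mindeg2 T -> mindeg2 (f @: T).
Proof.
move=> finj fadj [nT deg]; split; first by rewrite imset_eq0.
move=> y /imsetP[x xT ->]; apply: leq_trans (deg _ xT) _; exact: embeds_degree.
Qed.

(** Two cliques cover the ladder, so two of any three vertices lie in a common clique. *)
Lemma clique_ladder_free3 (H : sgraph) k :
  has_independent3 H -> induced_subdivision_free H (ladder true k).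
Proof.
move=> indep /itmP[H' sub [f finj fadj]].
have [a [b [c []]]] := subdivision_preserves (fun K u v _ => @subdivide_independent3 K u v) sub indep.
have nf x y : nadj x y -> (f x).1 != (f y).1.
  rewrite /nadj -fadj -(inj_eq finj) /= /ladder_adj; case: (f x) => b1 o1; case: (f y) => b2 o2.
  by rewrite xpair_eqE /=; case: eqVneq => //= _; rewrite andbT => /andP[/negPf ->].
move=> /nf + /nf + /nf.
by case: (f a).1; case: (f b).1; case: (f c).1.
Qed.

(** A triangle-free induced subgraph takes at most two vertices from each of the two cliques. *)
Lemma clique_ladder_triangle_free (H : sgraph) k :
  large_triangle_free H -> induced_subdivision_free H (ladder true k).
Proof.
move=> tf /itmP[H' sub [f finj fadj]].
have [sz tf'] := subdivision_preserves (fun K u v _ => @subdivide_large_triangle_free K u v) sub tf.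
pose A e := [set x : H' | (f x).1 == e].
have small e : #|A e| <= 2.
  rewrite leqNgt; apply/negP => /card_gt2P[x [y [z [[xA yA zA] [xy yz zx]]]]].
  have adjA a b : a \in A e -> b \in A e -> a != b -> adj a b.
    rewrite -fadj -(inj_eq finj) /= /ladder_adj !inE; case: (f a) => b1 o1; case: (f b) => b2 o2 /=.
    by move=> /eqP-> /eqP->; rewrite xpair_eqE eqxx /= andbT.
  by have /negP := tf' x y z; apply; rewrite !adjA // eq_sym.
have : #|H'| <= 4.
  rewrite -(cardsC (A true)); apply: (@leq_add _ _ 2 2) => //.
  have -> : ~: A true = A false by apply/setP => x; rewrite !inE; case: (f x).1.
  exact: small.
by rewrite leqNgt sz.
Qed.

(** The end of a rung sees only the hub of its side and the other end. *)
Lemma star_ladder_degree k (x : ladder false k) : 2 < #|[set y | adj x y]| -> x.2 = None.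
Proof.
case: x => e [i|] //; rewrite leqNgt => /negP[].
apply: leq_trans (_ : #|[set ((e, None) : ladder false k); (~~ e, Some i)]| <= 2).
  apply/subset_leq_card/subsetP => -[e' o']; rewrite !inE /= /ladder_adj /= !xpair_eqE.
  case: (e =P e') => [->|ne]; first by case/andP=> _ ->; rewrite eqxx.
  by case/andP=> /eqP <- _; move: ne; case: e; case: e'; rewrite // !eqxx ?orbT.
by rewrite cards2; case: (_ != _).
Qed.

Lemma star_ladder_three_branch (H : sgraph) k :
  three_branch H -> induced_subdivision_free H (ladder false k).
Proof.
move=> br /itmP[H' sub [f finj fadj]].
have [a [b [c [uabc da db dc]]]] := subdivision_preserves (fun K u v _ => @subdivide_three_branch K u v) sub br.
have hub x : 2 < #|[set y | adj x y]| -> (f x).2 = None.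
  move=> dx; apply: star_ladder_degree; apply: leq_trans dx _.
  rewrite -(card_imset _ finj); apply/subset_leq_card/subsetP => y.
  by case/imsetP=> z; rewrite !inE => xz ->; rewrite fadj.
have : uniq [:: f a; f b; f c] by rewrite -[[:: f a; _; _]]/(map f [:: a; b; c]) map_inj_uniq.
move: (hub _ da) (hub _ db) (hub _ dc).
case: (f a) => [e1 o1]; case: (f b) => [e2 o2]; case: (f c) => [e3 o3] /= -> -> ->.
by rewrite !inE !xpair_eqE !eqxx !andbT; case: e1; case: e2; case: e3.
Qed.

(** The end of a rung has only two neighbours, so [T] contains both, and likewise at the other end
    of that rung. A hub in [T] has a neighbour in [T], which is the end of a rung. *)
Lemma star_ladder_mindeg2 k (T : {set ladder false k}) : mindeg2 T ->
  forall e, (e, None) \in T.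
Proof.
move=> [/set0Pn[x0 x0T] deg].
have rung e i : (e, Some i) \in T -> (e, None) \in T /\ (~~ e, Some i) \in T.
  move=> xT; have := deg _ xT.
  have sub : [set y in T | @adj (ladder false k) (e, Some i) y] \subset
             [set ((e, None) : ladder false k); (~~ e, Some i)].
    apply/subsetP => -[e' o']; rewrite !inE /= /ladder_adj /= !xpair_eqE.
    case: (e =P e') => [->|ne]; first by case/and3P=> _ _ ->; rewrite eqxx.
    by case/and3P=> _ /eqP <- _; move: ne; case: (e); case: e'; rewrite // !eqxx ?orbT.
  move=> sz; have /eqP E : [set y in T | @adj (ladder false k) (e, Some i) y] ==
             [set ((e, None) : ladder false k); (~~ e, Some i)].
    by rewrite eqEcard sub cards2 xpair_eqE andbF.
  have : ((e, None) \in [set ((e, None) : ladder false k); (~~ e, Some i)]) /\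
         ((~~ e, Some i) \in [set ((e, None) : ladder false k); (~~ e, Some i)]).
    by rewrite set21 set22.
  by rewrite -E !inE => -[/andP[-> _] /andP[-> _]].
have hubs e i : (e, Some i) \in T -> forall b, (b, None) \in T.
  move=> /rung[e1 /rung[e2 _]] b.
  by have [->|] := eqVneq b e => //; move: e1 e2; case: e; case: b.
case: x0 x0T => e [i|] x0T; first exact: hubs x0T.
have := deg _ x0T; move/ltnW/card_gt0P => [[e' o']]; rewrite inE /= /ladder_adj /=.
case: (e =P e') => [<-|_]; last by rewrite !andbF.
by case: o' => [i|]; rewrite ?eqxx ?andbF // => /andP[/hubs].
Qed.

(** The image of the cycle contains both hubs, and every vertex is a hub or sees one. *)
Lemma star_ladder_undominated (H : sgraph) k :
  undominated_cycle H -> induced_subdivision_free H (ladder false k).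
Proof.
move=> br /itmP[H' sub [f finj fadj]].
have [T [v [dT vT nv]]] := subdivision_preserves (@subdivide_undominated) sub br.
have hubs := star_ladder_mindeg2 (embeds_mindeg2 finj fadj dT).
have nadjT e : ~~ adj (f v) (e, None).
  by have /imsetP[x xT ->] := hubs e; rewrite fadj nv.
have : f v \notin f @: T by rewrite (mem_imset _ _ finj).
have := nadjT (f v).1; case: (f v) => e [i|]; last by rewrite hubs.
by rewrite /= /ladder_adj /= eqxx.
Qed.

(** The images of both cycles contain both hubs and thus share two vertices. *)
Lemma star_ladder_edge_disjoint (H : sgraph) k :
  edge_disjoint_cycles H -> induced_subdivision_free H (ladder false k).
Proof.
move=> br /itmP[H' sub [f finj fadj]].
have [T [T' [dT dT' sz]]] := subdivision_preserves (@subdivide_edge_disjoint) sub br.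
have hubs := star_ladder_mindeg2 (embeds_mindeg2 finj fadj dT).
have hubs' := star_ladder_mindeg2 (embeds_mindeg2 finj fadj dT').
have : [set ((true, None) : ladder false k); (false, None)] \subset f @: (T :&: T').
  rewrite imsetI; last by move=> x y _ _; apply: finj.
  by apply/subsetP => x; rewrite !inE => /orP[]/eqP->; rewrite hubs hubs'.
move/subset_leq_card; rewrite card_imset // cards2 xpair_eqE /= => /leq_trans/(_ sz).
by [].
Qed.

(** * Graphs outside the list *)

Lemma triangle_mindeg2 (K : sgraph) (x y z : K) :
  adj x y -> adj y z -> adj x z -> mindeg2 [set x; y; z].
Proof.
move=> xy yz xz; split; first by apply/set0Pn; exists x; rewrite !inE eqxx.
move=> t; rewrite !inE => /orP[/orP[]|] /eqP->; apply/card_gt1P.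
- by exists y, z; rewrite !inE !eqxx !orbT /= (adj_neq yz).
- by exists x, z; rewrite !inE !eqxx !orbT /= adj_sym (adj_neq xz).
- by exists x, y; rewrite !inE !eqxx !orbT /= ![adj z _]adj_sym (adj_neq xy).
Qed.

Lemma undominated_triangle (K : sgraph) (v x y z : K) :
  adj x y -> adj y z -> adj x z -> nadj v x -> nadj v y -> nadj v z ->
  undominated_cycle K.
Proof.
move=> xy yz xz /andP[vx nvx] /andP[vy nvy] /andP[vz nvz].
exists [set x; y; z], v; split; first exact: triangle_mindeg2.
  by rewrite !inE !negb_or vx vy vz.
by move=> t; rewrite !inE => /orP[/orP[]|] /eqP->.
Qed.

Lemma large_order (H : sgraph) : 5 < #|H| ->
  [\/ has_independent3 H, three_branch H | undominated_cycle H].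
Proof.
move=> szH; pose D := [set x : H | 2 < #|[set y | adj x y]|].
have [/card_gt2P[a [b [c [[]]]]]|D2] := ltnP 2 #|D|.
  rewrite !inE => da db dc [ab bc ca]; apply: Or32; exists a, b, c; split=> //.
  by rewrite /= !inE negb_or ab bc eq_sym ca.
have /card_gt0P[v] : 0 < #|~: D| by rewrite cardsCs setCK subn_gt0 (leq_ltn_trans D2) // ltnW // ltnW // ltnW.
rewrite !inE -leqNgt => dv; pose N := [set x | nadj v x].
have NE : N = ~: (v |: [set y | adj v y]).
  by apply/setP => x; rewrite !inE negb_or eq_sym.
(* Of at least six vertices, [v] and at most two neighbours are removed. *)
have : 2 < #|N|.
  rewrite NE cardsCs setCK ltn_subRL; apply: leq_ltn_trans szH.
  rewrite cardsU1; apply: (@leq_trans (1 + 2 + 2)) => //; rewrite leq_add2r.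
  by apply: leq_add => //; apply: leq_b1.
case/card_gt2P=> x [y [z [[]]]]; rewrite !inE => vx vy vz [xy yz zx].
have [axy|nxy] := boolP (adj x y); last by apply: Or31; exists v, x, y; rewrite /nadj xy.
have [ayz|nyz] := boolP (adj y z); last by apply: Or31; exists v, y, z; rewrite /nadj yz.
have [axz|nxz] := boolP (adj x z); last by apply: Or31; exists v, x, z; split=> //; rewrite /nadj eq_sym zx.
by apply: Or33; apply: (undominated_triangle axy ayz axz vx vy vz).
Qed.

(* The conditionals keep the evaluation of [small_check] short-circuited. *)
Fixpoint anyb (T : Type) (p : T -> bool) (s : seq T) : bool :=
  if s is x :: s' then (if p x then true else anyb p s') else false.

Lemma anybP (T : eqType) (p : T -> bool) s : anyb p s -> exists2 x, x \in s & p x.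
Proof.
elim: s => //= x s IH; case: ifP => [px _|_ /IH[y ys py]].
  by exists x; rewrite ?mem_head.
by exists y; rewrite // inE ys orbT.
Qed.

(** * Exhaustive check of the graphs on at most five vertices *)

Section SmallCheck.
Variables (n : nat) (e : nat -> nat -> bool).
Let V := iota 0 n.

Definition ind3_check := anyb (fun a => anyb (fun b =>
  if (a != b) && ~~ e a b then
    anyb (fun c => [&& a != c, ~~ e a c, b != c & ~~ e b c]) V else false) V) V.

Definition triangle_check (p : nat -> nat -> nat -> bool) :=
  anyb (fun a => anyb (fun b => if e a b then
    anyb (fun c => if e a c && e b c then p a b c else false) V else false) V) V.

Definition undominated_check := triangle_check (fun a b c =>
  anyb (fun v => [&& v \notin [:: a; b; c], ~~ e v a, ~~ e v b & ~~ e v c]) V).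

(** Two triangles sharing only [a]: on at most five vertices, cycles with at most one common vertex
    have no other form. *)
Definition butterfly_check := triangle_check (fun a b c =>
  anyb (fun d => if (d \notin [:: b; c]) && e a d then
    anyb (fun f => [&& f \notin [:: b; c], e a f & e d f]) V else false) V).

Definition branch_check := anyb (fun a => if 2 < count (e a) V then
  anyb (fun b => if (a != b) && (2 < count (e b) V) then
    anyb (fun c => [&& a != c, b != c & 2 < count (e c) V]) V else false) V else false) V.

(** [s] lists the images of an embedding into the graph on [k] vertices with edge list [l]. *)
Definition embed_valid k (l : seq (nat * nat)) (s : seq nat) :=
  [&& size s == n, uniq s, all (fun i => i < k) s &
    all (fun i => all (fun j => e i j == [&& nth 0 s i != nth 0 s j &
      ((nth 0 s i, nth 0 s j) \in l) || ((nth 0 s j, nth 0 s i) \in l)]) V) V].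

Fixpoint injections m (l : seq nat) : seq (seq nat) :=
  if m is m'.+1 then
    flatten [seq [seq x :: s | s <- injections m' (rem x l)] | x <- l]
  else [:: [::]].

Definition embed_check k l := anyb (embed_valid k l) (injections n (iota 0 k)).

Definition two_P2_edges := [:: (0, 1); (2, 3)].
Definition diamond_edges := [:: (0, 1); (0, 2); (0, 3); (1, 2); (1, 3)].
Definition house_edges := [:: (0, 1); (1, 2); (2, 3); (3, 4); (0, 4); (0, 3)].

Definition small_check :=
  if ind3_check then true else
  if branch_check then true else
  if undominated_check then true else
  if (4 < n) && ~~ triangle_check (fun _ _ _ => true) then true else
  if butterfly_check then true else
  if embed_check 5 house_edges then true else
  if embed_check 4 diamond_edges then true else
  embed_check 4 two_P2_edges.

End SmallCheck.

(* The edges [(i, j)] with [i < j] are listed by increasing [j], then [i]. *)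
Definition bit_adj (b : seq bool) (i j : nat) : bool :=
  if i < j then nth false b (nth 0 [:: 0; 0; 1; 3; 6] j + i)
  else if j < i then nth false b (nth 0 [:: 0; 0; 1; 3; 6] i + j) else false.

Fixpoint all_bits m : seq (seq bool) :=
  if m is m'.+1 then
    [seq true :: b | b <- all_bits m'] ++ [seq false :: b | b <- all_bits m']
  else [:: [::]].

Lemma mem_all_bits b : b \in all_bits (size b).
Proof.
elim: b => // -[] b IH /=; rewrite mem_cat map_f ?orbT //.
Qed.

(** By evaluation on all adjacency vectors, at most $2^{10}$ for each order. *)
Lemma small_check_true n b : n < 6 -> size b = 'C(n, 2) -> small_check n (bit_adj b).
Proof.
move=> n6 szb; have := mem_all_bits b; rewrite szb; move: b {szb}.
apply/allP; move: n n6.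
by do 6?[case; first by vm_compute].
Qed.

(** * From the outcome of the check to the graph *)

Section SmallGraph.
Variables (H : sgraph) (x0 : H).
Let n := #|H|.
Let h i := nth x0 (enum H) i.
Variable e : nat -> nat -> bool.
Hypothesis eE : forall i j, i < n -> j < n -> e i j = adj (h i) (h j).

Let h_eq i j : i < n -> j < n -> (h i == h j) = (i == j).
Proof. by move=> ni nj; rewrite nth_uniq ?enum_uniq // -cardE. Qed.

Let nadj_h i j : i < n -> j < n -> i != j -> ~~ e i j -> nadj (h i) (h j).
Proof. by move=> ni nj ij; rewrite eE // /nadj h_eq // ij. Qed.

Let deg_h i : i < n -> #|[set y | adj (h i) y]| = count (e i) (iota 0 n).
Proof.
move=> ni; rewrite cardsE cardE size_filter -enumT.
have -> : enum H = [seq h j | j <- iota 0 n].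
  by rewrite -[LHS](mkseq_nth x0) -cardE.
rewrite count_map; apply: eq_in_count => j; rewrite mem_iota => /= nj.
by rewrite eE // inE.
Qed.

Lemma ind3_checkP : ind3_check n e -> has_independent3 H.
Proof.
case/anybP => a + /anybP[b]; rewrite !mem_iota => /= an bn.
case: ifP => // /andP[ab nab] /anybP[c]; rewrite mem_iota => /= cn /and4P[ac nac bc nbc].
by exists (h a), (h b), (h c); split; apply: nadj_h.
Qed.

Lemma branch_checkP : branch_check n e -> three_branch H.
Proof.
case/anybP => a; rewrite mem_iota => /= an; case: ifP => // da /anybP[b].
rewrite mem_iota => /= bn; case: ifP => // /andP[ab db] /anybP[c].
rewrite mem_iota => /= cn /and3P[ac bc dc].
exists (h a), (h b), (h c); rewrite !deg_h // da db dc; split=> //.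
by rewrite /= !inE negb_or !h_eq // ab ac bc.
Qed.

Lemma triangle_checkP p : triangle_check n e p -> exists a b c,
  [/\ a < n, b < n, c < n & [/\ adj (h a) (h b), adj (h a) (h c), adj (h b) (h c) & p a b c]].
Proof.
case/anybP => a + /anybP[b]; rewrite !mem_iota => /= an bn.
case: ifP => // ab /anybP[c]; rewrite mem_iota => /= cn; case: ifP => // /andP[ac bc] pabc.
by exists a, b, c; split=> //; split=> //; rewrite -eE.
Qed.

Lemma undominated_checkP : undominated_check n e -> undominated_cycle H.
Proof.
case/triangle_checkP=> a [b [c [an bn cn [ab ac bc]]]] /anybP[v].
rewrite mem_iota => /= vn; rewrite !inE !negb_or => /and4P[/and3P[va vb vc] nva nvb nvc].
by apply: (@undominated_triangle H (h v) (h a) (h b) (h c)) => //; apply: nadj_h.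
Qed.

Lemma butterfly_checkP : butterfly_check n e -> edge_disjoint_cycles H.
Proof.
case/triangle_checkP=> a [b [c [an bn cn [ab ac bc]]]] /anybP[d].
rewrite mem_iota => /= dn; case: ifP => // /andP[dbc ad] /anybP[f].
rewrite mem_iota => /= fn /and3P[fbc af df].
rewrite eE // in ad; rewrite eE // in af; rewrite eE // in df.
exists [set h a; h b; h c], [set h a; h d; h f]; split; try exact: triangle_mindeg2.
apply: leq_trans (_ : #|[set h a]| <= 1); last by rewrite cards1.
apply/subset_leq_card/subsetP => x; rewrite !inE.
move: dbc fbc; rewrite !inE !negb_or => /andP[db dc] /andP[fb fc].
case: eqVneq => //= _ /andP[/orP[]/eqP-> /orP[]]; rewrite h_eq // eq_sym.
- by rewrite (negPf db).
- by rewrite (negPf fb).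
- by rewrite (negPf dc).
- by rewrite (negPf fc).
Qed.

(** Here a failed check is used, so every triangle must be detected: [anyI] is the converse of
    [anybP]. *)
Lemma triangle_check_free : 4 < n -> ~~ triangle_check n e (fun _ _ _ => true) ->
  large_triangle_free H.
Proof.
move=> n4 nt; split=> // a b c; apply: contra nt => /and3P[ab bc ac].
have rk x : h (enum_rank x) = x by apply: nth_enum_rank.
have anyI (T : eqType) (p : T -> bool) s x : x \in s -> p x -> anyb p s.
  elim: s => //= y s IH; rewrite inE => /orP[/eqP->->//|xs px].
  by rewrite IH // if_same.
have rV (x : H) : nat_of_ord (enum_rank x) \in iota 0 n by rewrite mem_iota /=.
apply: (anyI _ _ _ _ (rV a)); apply: (anyI _ _ _ _ (rV b)).
rewrite eE // !rk ab; apply: (anyI _ _ _ _ (rV c)).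
by rewrite !eE // !rk ac bc.
Qed.

Lemma embed_checkP k l : embed_check n e k.+1 l -> embeds H (edge_list_graph k.+1 l).
Proof.
case/anybP => s _ /and4P[/eqP szs us /allP sk /allP ev].
pose f (x : H) : 'I_k.+1 := inord (nth 0 s (enum_rank x)).
have fE x : f x = nth 0 s (enum_rank x) :> nat.
  by rewrite inordK //; apply: sk; rewrite mem_nth // szs.
have rk x : h (enum_rank x) = x by apply: nth_enum_rank.
exists f => [x y /(congr1 val)|x y]; rewrite /= /edge_list_adj -?val_eqE /= !fE.
  by move/eqP; rewrite nth_uniq ?szs // => /eqP/val_inj/enum_rank_inj.
have rV (z : H) : nat_of_ord (enum_rank z) \in iota 0 n by rewrite mem_iota /=.
by have /allP/(_ _ (rV y))/eqP <- := ev _ (rV x); rewrite eE // !rk.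
Qed.

End SmallGraph.

Lemma graph_classification (H : sgraph) :
  [\/ embeds H two_P2 \/ embeds H diamond \/ embeds H house,
      has_independent3 H \/ large_triangle_free H |
      [\/ three_branch H, undominated_cycle H | edge_disjoint_cycles H]].
Proof.
have [szH|szH] := ltnP 5 #|H|.
  case: (large_order szH) => P.
  - by apply: Or32; left.
  - by apply: Or33; apply: Or31.
  - by apply: Or33; apply: Or32.
have [n0|/card_gt0P[x0 _]] := posnP #|H|.
  (* The graph without vertices offers no default value for [nth]; it embeds vacuously. *)
  have no (x : H) : False by have := card0_eq n0 x; rewrite inE.
  by apply: Or31; left; exists (fun x => ord0) => x; case: (no x).
pose h i := nth x0 (enum H) i.
pose b := flatten [seq [seq adj (h i) (h j) | i <- iota 0 j] | j <- iota 0 #|H|].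
have szb : size b = 'C(#|H|, 2).
  by rewrite /b; move: szH; case: #|H| => [|[|[|[|[|[|//]]]]]].
have eE i j : i < #|H| -> j < #|H| -> bit_adj b i j = adj (h i) (h j).
  rewrite /b; move: szH.
  case: #|H| => [|[|[|[|[|[|//]]]]]] _ // ; case: i => [|[|[|[|[|//]]]]] // _;
  case: j => [|[|[|[|[|//]]]]] // _; rewrite /bit_adj /= ?adj_irrefl //; by rewrite adj_sym.
have := small_check_true szH szb; rewrite /small_check.
case: ifP => [/(ind3_checkP eE) P _|_]; first by apply: Or32; left.
case: ifP => [/(branch_checkP eE) P _|_]; first by apply: Or33; apply: Or31.
case: ifP => [/(undominated_checkP eE) P _|_]; first by apply: Or33; apply: Or32.
case: ifP => [/andP[n4 nt] _|_].
  by apply: Or32; right; apply: (triangle_check_free eE).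
case: ifP => [/(butterfly_checkP eE) P _|_]; first by apply: Or33; apply: Or33.
case: ifP => [/(embed_checkP eE) P _|_]; first by apply: Or31; right; right.
case: ifP => [/(embed_checkP eE) P _|_ /(embed_checkP eE) P].
  by apply: Or31; right; left.
by apply: Or31; left.
Qed.

(** * The diamond in the house, and the cycle of implications *)

Lemma eq_set2 (T : finType) (x y u v : T) :
  ([set x; y] == [set u; v]) = (x == u) && (y == v) || (x == v) && (y == u).
Proof.
apply/eqP/orP => [E|[]/andP[/eqP-> /eqP->] //]; last by rewrite setUC.
have : (x \in [set u; v]) && (y \in [set u; v]) by rewrite -E set21 set22.
have : (u \in [set x; y]) && (v \in [set x; y]) by rewrite E set21 set22.
rewrite !inE !(eq_sym u) !(eq_sym v).
by case: (x == u); case: (y == v); case: (x == v); case: (y == u) => //; auto.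
Qed.

(** The house is the diamond with one edge at a vertex of degree 2 subdivided. Here this is the edge
    between 0 and 2, and the new vertex goes to vertex 1 of the house. *)
Lemma diamond_house : induced_topological_minor diamond house.
Proof.
pose u : diamond := @Ordinal 4 0 isT; pose v : diamond := @Ordinal 4 2 isT.
apply/itmP; exists (subdivide_edge u v).
  by apply: subdivision_step => //; apply: subdivision_refl.
pose f (x : option 'I_4) : 'I_5 :=
  inord (if x is Some i then nth 0 [:: 0; 3; 2; 4] i else 1).
have fE x : f x = (if x is Some i then nth 0 [:: 0; 3; 2; 4] i else 1) :> nat.
  by rewrite inordK //; case: x => [[[|[|[|[|//]]]] ?]|].
exists (f : subdivide_edge u v -> house) => [x y /(congr1 val)|x y].
  rewrite /= !fE.
  case: x => [[[|[|[|[|//]]]] ?]|]; case: y => [[[|[|[|[|//]]]] ?]|] //= _;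
  by congr Some; apply: val_inj.
rewrite /= /edge_list_adj -val_eqE /= !fE /subdivide_edge_adj.
case: x => [[[|[|[|[|//]]]] ?]|]; case: y => [[[|[|[|[|//]]]] ?]|] //=;
by rewrite ?eq_set2 ?inE.
Qed.

Theorem theorem1p8 (R : realType) (H : sgraph) :
  [<-> tame R (induced_subdivision_free H);
       ~ feral R (induced_subdivision_free H);
       induced_subgraph H two_P2 \/ induced_subgraph H diamond
         \/ induced_subgraph H house;
       induced_topological_minor H two_P2
         \/ induced_topological_minor H house].
Proof.
split; first exact: tame_not_feral.
split.
  move=> nferal.
  (* An obstruction in [H] puts all clique ladders or all star ladders into the class, which is then
     feral. *)
  case: (graph_classification H) => [[|[]] /induced_subgraphP emb|bad|bad].
  - by left.
  - by right; left.
  - by right; right.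
  - case: nferal; apply: (@feral_ladders R true) => k.
    case: bad => bad; [exact: clique_ladder_free3|exact: clique_ladder_triangle_free].
  - case: nferal; apply: (@feral_ladders R false) => k.
    case: bad => bad; [exact: star_ladder_three_branch|
      exact: star_ladder_undominated|exact: star_ladder_edge_disjoint].
split.
  case=> [|[]] /induced_subgraphP emb; first by left; apply: embeds_itm.
    by right; apply: itm_trans (embeds_itm emb) diamond_house.
  by right; apply: embeds_itm.
by case=> itm; [apply: tame_two_P2|apply: tame_house].
Qed.
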